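(* Let $q\geq 4$ be a prime power and let $Z$ and $\mathcal{L}_4$ be the surface over $\mathbf{F}_q$ and the line bundle described in the context. The code $C_L(Z,\mathcal{L}_4)$ has parameters $$[q^2+q+1,\ 12,\ q^2-2q-1],$$ i.e. length $q^2+q+1$, dimension $12$ and minimum distance $q^2-2q-1$.
   Context: Let $P$ be a closed point of degree $3$ of $\mathbf{P}^2$ over $\mathbf{F}_q$ which is not contained in any line defined over $\mathbf{F}_q$ (so over $\mathbf{F}_{q^3}$ it splits into three non collinear Frobenius-conjugate points). Let $\pi:Z\to\mathbf{P}^2$ be the blow up of $\mathbf{P}^2$ at $P$, with exceptional divisor $E$. Let $\Gamma_4$ be the linear system of plane curves of degree $4$ containing $P$, and let $\mathcal{L}_4$ be the line bundle on $Z$ associated to $\pi^{\star}\Gamma_4-E$ (so $\mathcal{L}_4\cong\mathcal{O}_Z(4\pi^{\star}L-E)$ with $L$ a line of $\mathbf{P}^2$). For a line bundle $\mathcal{L}$ on a smooth projective geometrically irreducible surface $X$ over $\mathbf{F}_q$ with rational points $X(\mathbf{F}_q)=\{P_1,\dots,P_n\}$ (all of them), the code $C_L(X,\mathcal{L})\subset \mathbf{F}_q^n$ is the image of the evaluation map $H^0(X,\mathcal{L})\to\bigoplus_i \mathcal{L}_{P_i}\simeq\mathbf{F}_q^n$, $f\mapsto (f_{P_1},\dots,f_{P_n})$, where a coordinate has been chosen on each fibre (different choices give codes isometric for the Hamming distance). A code with parameters $[n,k,d]$ has length $n$, dimension $k$ and minimum Hamming distance $d$. *)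

(* Defs.v *)
From mathcomp Require Export all_boot all_order all_algebra all_field.
From mathcomp Require Export fraction mpoly.

Set Implicit Arguments.
Unset Strict Implicit.
Unset Printing Implicit Defensive.

Import GRing.Theory.
Local Open Scope ring_scope.

(* Throughout, R = F[x0, x1, x2] is {mpoly F[3]}, the homogeneous coordinate
   ring of the projective plane, and its ideals are Prop-valued predicates.   *)

(** * Closed points of the plane *)

(* A closed point is given by homogeneous coordinates a of a point of P^2(K)
   lying over it, K/F being any finite extension.                             *)
Definition hom_coords (K : fieldType) (a : 'I_3 -> K) : Prop :=
  exists i, a i != 0.

(* Residue field F(a_i / a_j); for a_j = 0 the quotient is 0 by convention.   *)
Definition residue_field (F : fieldType) (K : fieldExtType F) (a : 'I_3 -> K) :
    {vspace K} :=
  <<1 & [seq a ij.1 / a ij.2 | ij : 'I_3 * 'I_3]>>%VS.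

Definition point_degree (F : fieldType) (K : fieldExtType F) (a : 'I_3 -> K) :
    nat :=
  \dim (residue_field a).

Definition evalK (F : fieldType) (K : fieldExtType F) (a : 'I_3 -> K)
    (f : {mpoly F[3]}) : K :=
  (map_mpoly (in_alg K) f).@[a].

(* The homogeneous ideal of the closed point: all homogeneous components
   vanish at a.                                                               *)
Definition point_ideal (F : fieldType) (K : fieldExtType F) (a : 'I_3 -> K)
    (f : {mpoly F[3]}) : Prop :=
  forall d, evalK a (pihomog mdeg d f) = 0.

Definition on_rational_line (F : fieldType) (K : fieldExtType F)
    (a : 'I_3 -> K) : Prop :=
  exists l : {mpoly F[3]}, [/\ l \is 1.-homog, l != 0 & point_ideal a l].

(** * Blow-up of the plane along a homogeneous ideal

   The blow-up of P^2 along the subscheme defined by I is Z = Proj of the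
   Rees algebra R[It], relative to P^2.  R[It] is bigraded: for f in I^n
   homogeneous of degree m, f t^n has bidegree (m, n).                         *)

Inductive ideal_pow (F : fieldType) (I : {mpoly F[3]} -> Prop) :
    nat -> {mpoly F[3]} -> Prop :=
| ideal_pow0 f : ideal_pow I 0 f
| ideal_powM n f g : I f -> ideal_pow I n g -> ideal_pow I n.+1 (f * g)
| ideal_powD n f g : ideal_pow I n f -> ideal_pow I n g ->
    ideal_pow I n (f + g).

(* The Rees algebra as a subring of R[t]; the variable t is 'X.               *)
Definition rees (F : fieldType) (I : {mpoly F[3]} -> Prop)
    (u : {poly {mpoly F[3]}}) : Prop :=
  forall n, ideal_pow I n u`_n.

(* Z is covered by the charts D(l * (g t)) with l in R_1 and g in I_d, and the
   complement of the irrelevant locus in Spec R[It] is a torsor over Z under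
   the torus Gm^2 of the bigrading.  As such torsors over a field are trivial,
   Z(F) is the set of F-algebra morphisms R[It] -> F that are nonzero on some
   l * (g t), modulo F^* x F^*.  Values of chi outside R[It] are irrelevant.  *)
Record blowup_point (F : fieldType) (I : {mpoly F[3]} -> Prop)
    (chi : {poly {mpoly F[3]}} -> F) : Prop := BlowupPoint {
  blowup_pointC : forall c : F, chi (c%:MP)%:P = c;
  blowup_pointD : forall u v, rees I u -> rees I v ->
    chi (u + v) = chi u + chi v;
  blowup_pointM : forall u v, rees I u -> rees I v ->
    chi (u * v) = chi u * chi v;
  blowup_point_base : exists2 l : {mpoly F[3]}, l \is 1.-homog &
    chi l%:P != 0;
  blowup_point_fibre : exists d (g : {mpoly F[3]}),
    [/\ g \is d.-homog, I g & chi (g *: 'X) != 0]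
}.

Definition same_point (F : fieldType) (I : {mpoly F[3]} -> Prop)
    (chi chi' : {poly {mpoly F[3]}} -> F) : Prop :=
  exists lam mu : F, [/\ lam != 0, mu != 0 &
    forall m n (f : {mpoly F[3]}), f \is m.-homog -> ideal_pow I n f ->
      chi' (f *: 'X^n) = lam ^+ m * mu ^+ n * chi (f *: 'X^n)].

(* pts lists each F-rational point of Z exactly once (one representative per
   torus orbit).                                                              *)
Definition rational_points (F : fieldType) (I : {mpoly F[3]} -> Prop) (n : nat)
    (pts : 'I_n -> {poly {mpoly F[3]}} -> F) : Prop :=
  [/\ forall i, blowup_point I (pts i),
      forall i j, same_point I (pts i) (pts j) -> i = j
    & forall chi, blowup_point I chi -> exists i, same_point I (pts i) chi].

(** * The line bundles O_Z(m L - e E)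

   The inverse image ideal sheaf I.O_Z = O_Z(-E) is the tautological sheaf
   O_Z(1) of Proj R[It], so O_Z(m L - e E) is the sheaf of bidegree (m, e).
   Its rational sections are the h t^e with h in Frac R of degree m.          *)

(* On the chart of l in R_1 and g in I_d, h t^e = u t^(N+e) / (l * (g t))^N
   with u t^(N+e) in R[It] of bidegree (m + N (d + 1), N + e).                *)
Definition chart_repr (F : fieldType) (I : {mpoly F[3]} -> Prop) (m e : nat)
    (h : {fraction {mpoly F[3]}}) (d : nat) (l g : {mpoly F[3]}) (N : nat)
    (u : {mpoly F[3]}) : Prop :=
  [/\ u \is (m + N * d.+1).-homog, ideal_pow I (N + e) u &
      h * tofrac ((l * g) ^+ N) = tofrac u].

(* Z is integral, so a global section is a rational section that is regular
   on every chart.                                                            *)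
Definition global_section (F : fieldType) (I : {mpoly F[3]} -> Prop)
    (m e : nat) (h : {fraction {mpoly F[3]}}) : Prop :=
  forall d (l g : {mpoly F[3]}), l \is 1.-homog -> g \is d.-homog -> I g ->
    exists N u, chart_repr I m e h d l g N u.

(* w is the value of h at chi, computed on a chart containing the point; the
   representative chi of the point fixes the coordinate on the fibre, which
   (lam, mu) in the torus rescales by lam^m mu^e.                             *)
Definition section_value (F : fieldType) (I : {mpoly F[3]} -> Prop)
    (m e : nat) (h : {fraction {mpoly F[3]}})
    (chi : {poly {mpoly F[3]}} -> F) (w : F) : Prop :=
  exists d (l g : {mpoly F[3]}) N u,
    [/\ [/\ l \is 1.-homog, g \is d.-homog & I g],
        chi l%:P != 0, chi (g *: 'X) != 0,
        chart_repr I m e h d l g N u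
      & w = chi (u *: 'X^(N + e)) / (chi l%:P * chi (g *: 'X)) ^+ N].

(** * Evaluation codes *)

(* C_L(Z, O_Z(m L - e E)).                                                    *)
Definition ag_code (F : fieldType) (I : {mpoly F[3]} -> Prop) (m e n : nat)
    (pts : 'I_n -> {poly {mpoly F[3]}} -> F) (w : 'rV[F]_n) : Prop :=
  exists2 h, global_section I m e h &
    forall i, section_value I m e h (pts i) (w ord0 i).

Definition hamming (F : fieldType) (n : nat) (v w : 'rV[F]_n) : nat :=
  #|[set i | v ord0 i != w ord0 i]|.

Definition min_distance (F : fieldType) (n : nat) (C : {vspace 'rV[F]_n})
    (d : nat) : Prop :=
  (exists v w, [/\ v \in C, w \in C, v != w & hamming v w = d]) /\
  (forall v w, v \in C -> w \in C -> v != w -> (d <= hamming v w)%N).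

Definition code_parameters (F : fieldType) (n : nat) (C : 'rV[F]_n -> Prop)
    (len k d : nat) : Prop :=
  n = len /\
  exists V : {vspace 'rV[F]_n},
    [/\ forall w, w \in V <-> C w, \dim V = k & min_distance V d].

(* Main.v *)
From HB Require Import structures.
Require Import Defs.
From mathcomp Require Import zify ring.

(** Write P for the cubic point, I for its ideal and q for the cardinal of F.

   The code is computed by quartic forms. A section of O(4 L - E) becomes a
   polynomial after multiplication by powers of two forms A and B of the ideal,
   where A is free of X_2 and B is monic in X_2; such powers form a regular
   sequence, so the section is a form f of degree 4, and because A vanishes at P
   to order exactly one, f belongs to I ([global_section_ideal]). Restricting a
   rational point of Z, a morphism on the Rees algebra, to its part of degree 0
   in t gives a point of the plane, from which it is recovered up to the torus
   because I has no rational zero ([chi_scale], [same_pointE]). So the rational points of Z are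
   the q^2 + q + 1 rational points of the plane, and a coordinate of the word of
   f is zero exactly when f vanishes at the corresponding point.

   Evaluation at P maps the 15-dimensional space of quartic forms onto the
   residue field, which has dimension 3; its kernel has dimension 12. It
   remains to show that the maximal number of rational zeros of a nonzero quartic
   form through P is 3 q + 2. As this is less than q^2 + q + 1 for q >= 4,
   the evaluation map is then injective too.

   Upper bound. Let f have degree d and no linear factor, and let p be a
   rational zero of f. Each of the q + 1 lines through p carries at most d - 1
   further zeros, and one less if it is tangent at p; at least one of the lines
   is tangent. So f has at most (d - 1)(q + 1) zeros. If there is equality and
   d >= 3, a tangent line at p carries another zero p', and the equality at p'
   forces that line to be tangent at p' as well; then it carries too few
   zeros. This gives q + 1, 2 q + 1 and 3 q + 2 in degrees 2, 3 and 4
   ([card_pzeros_le], [card_pzeros_lt]). A quartic form through P loses linear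
   factors one at a time; they do not vanish at P, so at most two of them occur,
   and in each case the total is at most 3 q + 2 ([quartic_bound]).

   Attained. Let x be a_1 / a_0. As 1, x and a_2 / a_0 form a basis of the
   residue field, there is a linear form m with value x^2 a_0 at P, so the conic
   X_0 m = X_1^2 passes through P. It has q + 1 points, parametrized by
   X_0 : X_1 : m = s^2 : s t : t^2, and a line is external to it when the binary
   quadratic form that it cuts out has no zero; two such lines add 2 q + 1
   points ([conic_two_external_lines], [extremal_quartic]). *)

Set Implicit Arguments.
Unset Strict Implicit.
Unset Printing Implicit Defensive.

Import GRing.Theory.
Local Open Scope ring_scope.

(** * Substitution into polynomials in several variables *)

Lemma eq_mmap (n : nat) (R S : nzRingType) (g g' : R -> S) (x x' : 'I_n -> S)
    (f : {mpoly R[n]}) :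
  g =1 g' -> x =1 x' -> mmap g x f = mmap g' x' f.
Proof.
move=> eg ex; apply: eq_bigr => m _; rewrite eg; congr (_ * _).
exact: mmap1_eq.
Qed.

Lemma mmap_mpolyX (n : nat) (R : comNzRingType) (f : {mpoly R[n]}) :
  mmap (@mpolyC n R) (fun i => 'X_i) f = f.
Proof.
rewrite [RHS]mpolyE; apply: eq_bigr => m _.
by rewrite mmap1_id mul_mpolyC.
Qed.

Lemma mmap_homogZ (n : nat) (R S : comNzRingType) (g : {rmorphism R -> S})
    (x : 'I_n -> S) (c : S) (d : nat) (f : {mpoly R[n]}) :
  f \is d.-homog ->
  mmap g (fun i => c * x i) f = c ^+ d * mmap g x f.
Proof.
move=> /dhomogP hf; rewrite /mmap mulr_sumr big_seq [RHS]big_seq.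
apply: eq_bigr => m mf; rewrite mulrCA; congr (_ * _).
rewrite -(hf m mf) /= mdegE -prodrXr -big_split /=.
by apply: eq_bigr => i _; rewrite exprMn.
Qed.

(** The restriction of f to the line through u in the direction v, as a
   polynomial in the affine parameter. *)
Definition line (n : nat) (R : comNzRingType) (f : {mpoly R[n]})
    (u v : 'rV[R]_n) : {poly R} :=
  mmap polyC (fun i => (u 0 i)%:P + v 0 i *: 'X) f.

Section Homogenization.
Context (R S : comNzRingType) (g : {rmorphism R -> S}) (s t : S).

Let hval (d : nat) (A : {poly R}) : S :=
  \sum_(k < d.+1) g A`_k * s ^+ (d - k) * t ^+ k.

Let dehom (d : nat) (A : {poly R}) (y : S) := (size A <= d.+1)%N /\ y = hval d A.

Let dehom1 : dehom 0 1 1.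
Proof.
split; first by rewrite size_poly1.
by rewrite /hval big_ord1 coef1 rmorph1 !mulr1.
Qed.

Let dehomM d A y a b : dehom d A y ->
  dehom d.+1 (A * (a%:P + b *: 'X)) (y * (s * g a + t * g b)).
Proof.
case=> sA ->; split.
  apply: leq_trans (size_polyMleq _ _) _.
  have sL : (size (a%:P + b *: 'X)%R <= 2)%N.
    rewrite (leq_trans (size_polyD _ _)) // geq_max.
    rewrite (leq_trans (size_polyC_leq1 _)) //.
    by rewrite (leq_trans (size_scale_leq _ _)) // size_polyX.
  by have := leq_add sA sL; lia.
have cE k : (A * (a%:P + b *: 'X))`_k
    = A`_k * a + (if k is k'.+1 then A`_k' * b else 0).
  rewrite mulrDr coefD coefMC -scalerAr coefZ coefMX.
  by case: k => [|k] /=; rewrite ?mulr0 // [b * _]mulrC.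
rewrite {2}/hval.
under eq_bigr => k _ do rewrite cE rmorphD !mulrDl.
rewrite big_split /= mulrDr; congr (_ + _).
  rewrite big_ord_recr /= [A`_d.+1]nth_default // mul0r rmorph0 !mul0r addr0.
  rewrite mulr_suml; apply: eq_bigr => k _ /=.
  by rewrite subSn -1?ltnS ?ltn_ord // rmorphM exprS; ring.
rewrite big_ord_recl /= rmorph0 !mul0r add0r mulr_suml.
by apply: eq_bigr => k _ /=; rewrite subSS rmorphM exprS; ring.
Qed.

Let dehomX d A y a b k : dehom d A y ->
  dehom (d + k) (A * (a%:P + b *: 'X) ^+ k) (y * (s * g a + t * g b) ^+ k).
Proof.
elim: k => [|k IH] h; first by rewrite addn0 !expr0 !mulr1.
by rewrite addnS !exprSr !mulrA; apply: dehomM; apply: IH.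
Qed.

(** Both sides are multiplicative in f, up to the degrees, so it is enough to
   compare them on linear factors. The case where S is the polynomial ring and
   (s, t) = ('X, 1) exchanges the roles of u and v; the case of linear forms s
   and t shows that a form which is zero on a line is zero on the generic point
   of that line. *)
Lemma line_homogenize (n d : nat) (f : {mpoly R[n]}) (u v : 'rV[R]_n) :
  f \is d.-homog ->
  (size (line f u v) <= d.+1)%N /\
  mmap g (fun i => s * g (u 0 i) + t * g (v 0 i)) f =
  \sum_(k < d.+1) g (line f u v)`_k * s ^+ (d - k) * t ^+ k.
Proof.
move=> /dhomogP hf; rewrite -/(hval d _) -/(dehom d _ _) /mmap /line /mmap.
have mono m : dehom (mdeg m) (mmap1 (fun i => (u 0 i)%:P + v 0 i *: 'X) m)
   (mmap1 (fun i => s * g (u 0 i) + t * g (v 0 i)) m).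
  rewrite mdegE /mmap1.
  elim/big_rec3: _ => [|i y2 y1 k _]; first exact: dehom1.
  by rewrite [_ * y2]mulrC [_ * y1]mulrC addnC; apply: dehomX.
rewrite big_seq [X in dehom _ _ X]big_seq.
elim/big_rec2: _ => [|m A y mf [sy ->]].
  split; first by rewrite size_poly0.
  by rewrite /hval big1 // => k _; rewrite coef0 rmorph0 !mul0r.
have [sm ->] := mono m; rewrite (hf _ mf) in sm *; split.
  rewrite (leq_trans (size_polyD _ _)) // geq_max sy andbT.
  by rewrite mul_polyC (leq_trans (size_scale_leq _ _)).
rewrite /hval mulr_sumr -big_split /=; apply: eq_bigr => k _.
by rewrite coefD coefCM rmorphD rmorphM !mulrDl !mulrA.
Qed.

End Homogenization.

Lemma mpoly_ring_ind (n : nat) (R : comNzRingType) (P : {mpoly R[n]} -> Prop) :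
  (forall c, P c%:MP) -> (forall i, P 'X_i) ->
  (forall f g, P f -> P g -> P (f + g)) ->
  (forall f g, P f -> P g -> P (f * g)) ->
  forall f, P f.
Proof.
move=> PC PX PD PM f; rewrite (mpolyE f).
elim/big_ind: _ => [|//|m _]; first by rewrite -(mpolyC0 n R).
rewrite -mul_mpolyC; apply: (PM) => //; rewrite mpolyXE_id.
elim/big_ind: _ => [|x y px py|i _]; first by rewrite -(mpolyC1 n R).
  exact: (PM).
elim: (m i) => [|k IH]; first by rewrite expr0 -(mpolyC1 n R).
by rewrite exprS; apply: (PM).
Qed.

Lemma rmorph_mmap_comp (n : nat) (R S T : comNzRingType)
    (phi : {rmorphism S -> T}) (g : {rmorphism R -> S}) (x : 'I_n -> S)
    (f : {mpoly R[n]}) :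
  phi (mmap g x f) = mmap (phi \o g) (phi \o x) f.
Proof.
elim/mpoly_ring_ind: f => [c|i|f h IHf IHh|f h IHf IHh].
- by rewrite !mmapC.
- by rewrite !mmapX !mmap1U.
- by rewrite !mmapD rmorphD IHf IHh.
- by rewrite !rmorphM /= IHf IHh.
Qed.

Lemma horner_line (n : nat) (R : comNzRingType) (f : {mpoly R[n]})
    (u v : 'rV[R]_n) (t : R) :
  (line f u v).[t] = f.@[(u + t *: v) 0].
Proof.
rewrite -/(horner_eval t _) /line rmorph_mmap_comp; apply: eq_mmap => [c|i] /=.
  by rewrite horner_evalE hornerC.
by rewrite horner_evalE !hornerE !mxE mulrC.
Qed.

Lemma line_coef0 (n : nat) (R : comNzRingType) (f : {mpoly R[n]})
    (u v : 'rV[R]_n) :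
  (line f u v)`_0 = f.@[u 0].
Proof. by rewrite -horner_coef0 horner_line scale0r addr0. Qed.

(** The differential of f at u applied to v; its vanishing says that the line
   through u in the direction v is tangent at u. *)
Definition polar (n : nat) (R : comNzRingType) (f : {mpoly R[n]})
    (u v : 'rV[R]_n) : R :=
  \sum_i v 0 i * (f^`M(i)).@[u 0].

Lemma line_coef1 (n : nat) (R : comNzRingType) (f : {mpoly R[n]})
    (u v : 'rV[R]_n) :
  (line f u v)`_1 = polar f u v.
Proof.
rewrite /polar; elim/mpoly_ring_ind: f => [c|i|f h IHf IHh|f h IHf IHh].
- rewrite /line mmapC coefC /= big1 // => i _.
  by rewrite mderivC meval0 mulr0.
- rewrite /line mmapX mmap1U coefD coefC add0r coefZ coefX mulr1.
  rewrite (bigD1 i) //= big1 => [|j ji].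
    rewrite mderivX mnm1E eqxx -{1}[U_(i)%MM]add0m addmK mpolyX0.
    by rewrite scale1r meval1 mulr1 addr0.
  by rewrite mderivX mnm1E eq_sym (negbTE ji) mulr0n scale0r meval0 mulr0.
- rewrite /line mmapD coefD IHf IHh -big_split; apply: eq_bigr => i _ /=.
  by rewrite mderivD mevalD mulrDr.
- rewrite /line rmorphM /= coefM big_ord_recl big_ord1 /= subn0 subnn.
  rewrite -/(line f u v) -/(line h u v) IHf IHh !line_coef0.
  rewrite mulr_sumr mulr_suml -big_split; apply: eq_bigr => i _ /=.
  by rewrite mderivM mevalD !mevalM; ring.
Qed.

Lemma polarD (n : nat) (R : comNzRingType) (f : {mpoly R[n]})
    (u v w : 'rV[R]_n) : polar f u (v + w) = polar f u v + polar f u w.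
Proof.
by rewrite -big_split; apply: eq_bigr => i _; rewrite mxE mulrDl.
Qed.

Lemma polarZ (n : nat) (R : comNzRingType) (f : {mpoly R[n]})
    (u v : 'rV[R]_n) (c : R) : polar f u (c *: v) = c * polar f u v.
Proof. by rewrite mulr_sumr; apply: eq_bigr => i _; rewrite mxE mulrA. Qed.

Section HomogLine.
Context (n d : nat) (R : comNzRingType) (f : {mpoly R[n]}).
Hypothesis hf : f \is d.-homog.

Lemma size_line (u v : 'rV[R]_n) : (size (line f u v) <= d.+1)%N.
Proof. by have [] := line_homogenize (idfun : {rmorphism R -> R}) 0 0 u v hf. Qed.

Lemma meval_homogZ (c : R) (x : 'rV[R]_n) :
  f.@[(c *: x) 0] = c ^+ d * f.@[x 0].
Proof.
rewrite -(mmap_homogZ (idfun : {rmorphism R -> R}) _ _ hf).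
by apply: eq_mmap => // i; rewrite mxE.
Qed.

Lemma line_rev (u v : 'rV[R]_n) k :
  (k <= d)%N -> (line f v u)`_k = (line f u v)`_(d - k).
Proof.
move=> kd.
have [_] := line_homogenize (polyC : {rmorphism R -> {poly R}}) 'X 1 u v hf.
rewrite (_ : mmap _ _ _ = line f v u); last first.
  apply: eq_mmap => // i /=.
  by rewrite mul1r addrC -mul_polyC mulrC.
move=> ->; rewrite coef_sum.
have dk : (d - k < d.+1)%N by lia.
rewrite (bigD1 (Ordinal dk)) //= big1 => [|j /negP jn].
  by rewrite expr1n mulr1 coefCM coefXn subKn // eqxx mulr1 addr0.
rewrite expr1n mulr1 coefCM coefXn; case: eqP => [kj|]; last by rewrite mulr0.
case: jn; apply/eqP/val_inj => /=; have := ltn_ord j; lia.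
Qed.

(** By homogeneity, f((1 + X) u) = (1 + X)^d f(u). *)
Lemma polar_self (u : 'rV[R]_n) : f.@[u 0] = 0 -> polar f u u = 0.
Proof.
move=> fu; rewrite -line_coef1.
have -> : line f u u = (1 + 'X) ^+ d * (f.@[u 0])%:P.
  rewrite -[X in _ * X]/(polyC _) [polyC _](rmorph_mmap_comp
    (polyC : {rmorphism R -> {poly R}}) (idfun : {rmorphism R -> R})).
  rewrite -mmap_homogZ //; apply: eq_mmap => // i /=.
  by rewrite mulrDl mul1r -mul_polyC mulrC.
by rewrite fu mulr0 coef0.
Qed.

End HomogLine.

(** * Linear forms and linear factors *)

(** Multiplication by r shifts the homogeneous components of c by e, and it is
   injective. *)
Lemma dhomog_factor (n : nat) (R : idomainType) (e d : nat)
    (r c : {mpoly R[n]}) :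
  r \is e.-homog -> r != 0 -> r * c \is (e + d).-homog -> c \is d.-homog.
Proof.
move=> hr r0 hrc.
have comp k : k != d -> pihomog mdeg k c = 0.
  move=> kd; apply: (mulfI r0); rewrite mulr0.
  have -> : r * pihomog mdeg k c = pihomog mdeg (e + k) (r * c).
    have cE := @pihomog_partitionE n R mdeg (maxn (msize c) k.+1) c (leq_maxl _ _).
    rewrite [in RHS]cE [in RHS]mulr_sumr linear_sum /=.
    have kM : (k < maxn (msize c) k.+1)%N by rewrite leq_maxr.
    rewrite (bigD1 (Ordinal kM)) //= big1 => [|j jk].
      by rewrite addr0 [RHS]pihomog_dE // dhomogM // pihomogP.
    apply: (@pihomog_ne0 _ _ _ (e + j)).
      by rewrite eqn_add2l.
    by rewrite dhomogM // pihomogP.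
  by rewrite (@pihomog_ne0 _ _ _ (e + d)) // eqn_add2l eq_sym.
rewrite (@pihomog_partitionE n R mdeg (maxn (msize c) d.+1) c (leq_maxl _ _)).
apply: rpred_sum => j _; have [->|/comp ->] := eqVneq (j : nat) d.
  exact: pihomogP.
exact: dhomog0.
Qed.

Lemma homogX (R : nzRingType) (n : nat) (i : 'I_n) k :
  ('X_i ^+ k : {mpoly R[n]}) \is k.-homog.
Proof.
have := @dhomogMn n R mdeg 1 'X_i k; rewrite mul1n; apply.
by rewrite dhomogX /= mdeg1.
Qed.

Lemma homogX1 (R : nzRingType) (n : nat) (i : 'I_n) :
  ('X_i : {mpoly R[n]}) \is 1.-homog.
Proof. exact: (homogX R i 1). Qed.

Lemma mpolyX_neq0 (R : nzRingType) (n : nat) (i : 'I_n) :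
  ('X_i : {mpoly R[n]}) != 0.
Proof. by rewrite -msupp_eq0 msuppX. Qed.

Definition lform (R : comNzRingType) (n : nat) (c : 'cV[R]_n) : {mpoly R[n]} :=
  \sum_i c i 0 *: 'X_i.

Lemma lform_homog (R : comNzRingType) (n : nat) (c : 'cV[R]_n) :
  lform c \is 1.-homog.
Proof. by apply: rpred_sum => i _; rewrite rpredZ // homogX1. Qed.

Lemma mcoeff_lform (R : comNzRingType) (n : nat) (c : 'cV[R]_n) i :
  (lform c)@_U_(i) = c i 0.
Proof.
rewrite raddf_sum /= (bigD1 i) //= mcoeffZ mcoeffX eqxx mulr1 big1 ?addr0 //.
by move=> j ji; rewrite mcoeffZ mcoeffX eq_mnm1 (negbTE ji) mulr0.
Qed.

Lemma lform_eq0 (R : comNzRingType) (n : nat) (c : 'cV[R]_n) :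
  (lform c == 0) = (c == 0).
Proof.
apply/eqP/eqP => [h|->].
  by apply/colP => i; rewrite -mcoeff_lform h mcoeff0 mxE.
by rewrite /lform big1 // => i _; rewrite mxE scale0r.
Qed.

Lemma homog1_lform (R : comNzRingType) (n : nat) (r : {mpoly R[n]}) :
  r \is 1.-homog -> exists c, r = lform c.
Proof.
move=> /dhomogP hr; exists (\col_i r@_U_(i)).
apply/mpolyP => m; have [/eqP/mdeg1P [i /eqP ->]|m1] := eqVneq (mdeg m) 1%N.
  by rewrite mcoeff_lform mxE.
rewrite (dhomog_nemf_coeff (lform_homog _) m1).
by apply/memN_msupp_eq0/negP => /hr /eqP; rewrite (negbTE m1).
Qed.

Lemma meval_lform (R : comNzRingType) (n : nat) (c : 'cV[R]_n) (x : 'rV[R]_n) :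
  (lform c).@[x 0] = (x *m c) 0 0.
Proof.
rewrite raddf_sum mxE; apply: eq_bigr => i _ /=.
by rewrite mevalZ mevalXU mulrC.
Qed.

(** The Taylor expansion of f at x, to order zero. *)
Lemma mmapD_cong (n : nat) (R S : comNzRingType) (g : {rmorphism R -> S})
    (x y : 'I_n -> S) (r : S) (f : {mpoly R[n]}) :
  exists c, mmap g (fun i => x i + r * y i) f = mmap g x f + r * c.
Proof.
elim/mpoly_ring_ind: f => [c|i|f h [a Ha] [b Hb]|f h [a Ha] [b Hb]].
- by exists 0; rewrite !mmapC mulr0 addr0.
- by exists (y i); rewrite !mmapX !mmap1U.
- by exists (a + b); rewrite !mmapD Ha Hb; ring.
- exists (a * mmap g x h + mmap g x f * b + r * a * b).
  by rewrite !rmorphM /= Ha Hb; ring.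
Qed.

Lemma extend_to_unitmx (F : fieldType) (u v : 'rV[F]_3) :
  u != 0 -> (forall t, v != t *: u) ->
  exists2 M : 'M[F]_3, M \in unitmx & row 0 M = u /\ row 1 M = v.
Proof.
move=> u0 vu.
have r2 : \rank (u + v)%MS = 2.
  have := mxrank_sum_cap u v; rewrite !rank_rV u0.
  have -> : v != 0 by have := vu 0; rewrite scale0r.
  suff -> : \rank (u :&: v)%MS = 0%N by rewrite addn0.
  apply/eqP; rewrite mxrank_eq0; apply/negPn/negP => cap0.
  have vc : (v <= u :&: v)%MS.
    have := mxrank_leqif_sup (capmxSr u v); rewrite rank_rV.
    have -> : v != 0 by have := vu 0; rewrite scale0r.
    by case=> _ <-; rewrite eqn_leq -[X in _ && X]/(0 < _)%N lt0n mxrank_eq0 cap0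
      andbT (leq_trans (mxrankS (capmxSr u v))) // rank_leq_row.
  have /sub_rVP [t /eqP] := submx_trans vc (capmxSl u v).
  by rewrite (negbTE (vu t)).
have [k wk] : exists k, ~~ (row k (1%:M : 'M[F]_3) <= u + v)%MS.
  apply/existsP; rewrite -negb_forall; apply/negP => /forallP h.
  have /mxrankS : (1%:M <= u + v)%MS by apply/row_subP.
  by rewrite mxrank1 r2.
set w := row k _ in wk.
pose M := \matrix_(i < 3) nth 0 [:: u; v; w] i.
have rM i : row i M = nth 0 [:: u; v; w] i by rewrite rowK.
exists M; last by rewrite !rM.
have uvM : (u + v <= M)%MS.
  by rewrite addsmx_sub -[X in (X <= _)%MS && _](rM 0)
    -[X in _ && (X <= _)%MS](rM 1) !row_sub.
have wM : (w <= M)%MS.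
  by have := row_sub (inord 2) M; rewrite rM inordK.
rewrite -row_free_unit -row_leq_rank.
have lt2 : (\rank (u + v)%MS < \rank M)%N.
  rewrite ltn_neqAle mxrankS // andbT; apply: contra wk => /eqP e.
  have := mxrank_leqif_sup uvM => -[_]; rewrite e eqxx => /esym.
  exact: submx_trans.
by rewrite r2 in lt2.
Qed.

(** In coordinates s, t, r of a basis that starts with u and v, the form f
   is congruent modulo r to its restriction f(s u + t v), which is zero; so r
   divides f. *)
Lemma line_eq0_factor (F : fieldType) (d : nat) (f : {mpoly F[3]})
    (u v : 'rV[F]_3) :
  f \is d.-homog -> u != 0 -> (forall t, v != t *: u) -> line f u v = 0 ->
  exists r c, [/\ r \is 1.-homog, r != 0 & f = r * c].
Proof.
move=> hf u0 vu f0; have [M Mu [Mr0 Mr1]] := extend_to_unitmx u0 vu.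
pose L j := lform (col j (invmx M)).
have XE i : 'X_i = \sum_j L j * (M j i)%:MP_[3].
  under eq_bigr => j _ do rewrite mulr_suml.
  rewrite exchange_big /=.
  transitivity (\sum_k ((invmx M *m M) k i) *: 'X_k : {mpoly F[3]}).
    rewrite mulVmx // (bigD1 i) //= mxE eqxx scale1r big1 ?addr0 // => k ki.
    by rewrite mxE (negbTE ki) scale0r.
  apply: eq_bigr => k _; rewrite mxE scaler_suml; apply: eq_bigr => j _.
  by rewrite mxE -[RHS]mulrC mul_mpolyC scalerA mulrC.
pose s := L 0; pose t := L 1; pose r := L (inord 2).
have XE' i : 'X_i = s * (u 0 i)%:MP + t * (v 0 i)%:MP + r * (M (inord 2) i)%:MP.
  rewrite XE !big_ord_recl big_ord0 addr0 addrA -Mr0 -Mr1 !mxE.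
  have e1 : lift ord0 ord0 = 1 :> 'I_3 by apply/val_inj.
  have e2 : lift ord0 (lift ord0 ord0) = inord 2 :> 'I_3.
    by apply/val_inj; rewrite /= inordK.
  by rewrite e2 e1.
have [c fE] := mmapD_cong (@mpolyC 3 F : {rmorphism F -> {mpoly F[3]}})
  (fun i => s * (u 0 i)%:MP + t * (v 0 i)%:MP)
  (fun i => (M (inord 2) i)%:MP) r f.
exists r, c; split; first exact: lform_homog.
  rewrite lform_eq0; apply/negP => /eqP c0.
  have /matrixP /(_ (inord 2) (inord 2)) := mulmxV Mu.
  rewrite !mxE eqxx big1 => [/eqP|k _]; first by rewrite eq_sym oner_eq0.
  by have /colP /(_ k) := c0; rewrite !mxE => ->; rewrite mulr0.
have [_] := line_homogenize (@mpolyC 3 F : {rmorphism F -> {mpoly F[3]}}) s t u v hf.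
rewrite f0 big1 => [e|k _]; last by rewrite coef0 rmorph0 !mul0r.
rewrite e add0r in fE; rewrite -fE -[LHS]mmap_mpolyX.
by apply: eq_mmap => // i; exact: XE'.
Qed.

(** * Zeros of a ternary form over a finite field *)

Lemma card_roots_le (F : finFieldType) (A : {poly F}) :
  A != 0 -> (#|[set t | root A t]| < size A)%N.
Proof.
move=> A0; rewrite cardE; apply: max_poly_roots => //; last exact: enum_uniq.
by apply/allP => t; rewrite mem_enum inE.
Qed.

(** A double root at 0 costs one root. *)
Lemma card_roots_double (F : finFieldType) (A : {poly F}) :
  A != 0 -> A`_0 = 0 -> A`_1 = 0 ->
  (#|[set t | root A t]| + 2 <= size A)%N.
Proof.
move=> A0 a0 a1; pose B := drop_poly 2 A.
have AE : A = B * 'X^2.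
  rewrite -{1}(poly_take_drop 2 A) (_ : take_poly 2 A = 0) ?add0r //.
  apply/polyP => i; rewrite coef_take_poly coef0.
  by case: i => [|[|i]] //=.
have B0 : B != 0 by apply: contraNneq A0; rewrite AE => ->; rewrite mul0r.
have sA : size A = (size B).+2 by rewrite AE size_mulXn // add2n.
rewrite sA addn2 !ltnS.
have sub : [set t | root A t] \subset 0 |: [set t | root B t].
  apply/subsetP => t; rewrite !inE AE rootM.
  case/orP => [->|]; first by rewrite orbT.
  by rewrite rootE hornerXn expf_eq0 /= => ->.
rewrite (leq_trans (subset_leq_card sub)) // (leq_trans (leq_card_setU _ _)) //.
by rewrite cards1 add1n card_roots_le.
Qed.

(** A nonempty fiber is a translate of the kernel. *)
Lemma leq_card_fibers (V W : finZmodType) (phi : V -> W) :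
  {morph phi : x y / x - y} ->
  (#|V| <= #|W| * #|[set v | phi v == 0%R]|)%N.
Proof.
move=> phiB; rewrite -[leqLHS]sum1_card (partition_big phi predT) //=.
rewrite -sum_nat_const; apply: leq_sum => w _; rewrite sum1_card.
have [x /eqP xw|e] := pickP [pred v | phi v == w]; last first.
  by rewrite (@eq_card0 _ [pred v | phi v == w]).
rewrite -(card_imset _ (subIr x)) subset_leq_card //.
apply/subsetP => _ /imsetP [v vw ->].
by move: vw; rewrite !inE phiB => /eqP ->; rewrite xw subrr.
Qed.

(** The affine cone of the curve f = 0 without its vertex: each rational point
   of the curve counts q - 1 times. *)
Definition zeros (F : finFieldType) (f : {mpoly F[3]}) : {set 'rV[F]_3} :=
  [set v : 'rV[F]_3 | (v != 0) && (f.@[v 0] == 0)].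

(** The restriction is nonzero as a polynomial, not only as a function on F: if it
   is the zero polynomial, the line is a component whatever the degree is
   ([line_eq0_factor]). *)
Definition no_line (F : fieldType) (f : {mpoly F[3]}) : Prop :=
  forall p v : 'rV[F]_3, p != 0 -> (forall t, v != t *: p) -> line f p v != 0.

Lemma linear_factor_or_no_line (F : finFieldType) (d : nat) (f : {mpoly F[3]}) :
  f \is d.-homog ->
  (exists r c, [/\ r \is 1.-homog, r != 0 & f = r * c]) \/ no_line f.
Proof.
move=> hf.
have [[p v] /= /and3P [p0 /forallP vp /eqP l0]|h] :=
  pickP [pred pv : 'rV[F]_3 * 'rV[F]_3 | [&& pv.1 != 0,
    [forall t : F, pv.2 != t *: pv.1] & line f pv.1 pv.2 == 0]].
  by left; apply: line_eq0_factor hf p0 vp l0.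
right=> p v p0 vp; have := h (p, v); rewrite /= p0 /=.
by have -> /= : [forall t : F, v != t *: p]; [apply/forallP|move=> ->].
Qed.

Section Count.
Context (F : finFieldType) (d : nat) (f : {mpoly F[3]}).
Hypotheses (hf : f \is d.-homog) (nl : no_line f).
Implicit Types p v : 'rV[F]_3.
Let q := #|F|.
Let span (p : 'rV[F]_3) : {set 'rV[F]_3} := [set t *: p | t : F].
(** Number of zeros, other than p, on the line that joins p and v. *)
Let onl (p v : 'rV[F]_3) := #|[set t : F | f.@[(v + t *: p) 0] == 0]|.

Let q_gt1 : (1 < q)%N. Proof. exact: finNzRing_gt1. Qed.

Let spanN p v : v \notin span p -> forall t, v != t *: p.
Proof. by move=> vp t; apply: contraNneq vp => ->; apply: imset_f. Qed.

Let span_sym p v : p != 0 -> v \notin span p -> v != 0 /\ p \notin span v.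
Proof.
move=> p0 /spanN vp; split; first by have := vp 0; rewrite scale0r.
apply/negP => /imsetP [t _ pE]; have [t0|t0] := eqVneq t 0.
  by rewrite pE t0 scale0r eqxx in p0.
by have := vp t^-1; rewrite pE scalerA mulVf // scale1r eqxx.
Qed.

Let line_neq0 p v : p != 0 -> v \notin span p -> line f p v != 0.
Proof.
by move=> p0 /spanN; apply: nl.
Qed.

Let onl_roots p v : onl p v = #|[set t | root (line f v p) t]|.
Proof. by apply: eq_card => t; rewrite !inE rootE horner_line. Qed.

(** The coefficient of degree d of f(v + X p) is f(p), and the next one is the
   polar of f at p in the direction v. *)
Let size_line_zero p v : p != 0 -> f.@[p 0] = 0 -> v \notin span p ->
  (size (line f v p) + (polar f p v == 0)%R <= d)%N.
Proof.
move=> p0 fp vp; have s1 := size_line hf v p.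
have [v0 pv] := span_sym p0 vp.
have cd : (line f v p)`_d = 0.
  by rewrite (line_rev hf) // subnn line_coef0.
have s2 : (size (line f v p) <= d)%N.
  apply/leq_sizeP => j; rewrite leq_eqVlt => /orP [/eqP <- //|dj].
  by rewrite nth_default // (leq_trans s1).
case: eqP => [tp|_]; last by rewrite addn0.
have d_gt0 : (0 < d)%N.
  by rewrite (leq_trans _ s2) // size_poly_gt0 line_neq0.
rewrite addn1 -(prednK d_gt0) ltnS; apply/leq_sizeP => j.
rewrite leq_eqVlt => /orP [/eqP <-|dj]; last first.
  by rewrite nth_default // (leq_trans s2) // -(prednK d_gt0).
by rewrite (line_rev hf) ?leq_pred // -subn1 subKn // line_coef1.
Qed.

Let onl_lt p v : p != 0 -> f.@[p 0] = 0 -> v \notin span p ->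
  (onl p v + (polar f p v == 0)%R < d)%N.
Proof.
move=> p0 fp vp; apply: leq_trans (size_line_zero p0 fp vp).
have [v0 pv] := span_sym p0 vp.
by rewrite ltn_add2r onl_roots card_roots_le // line_neq0.
Qed.

Let onl_double p v : p != 0 -> f.@[p 0] = 0 -> v \notin span p ->
  f.@[v 0] = 0 -> polar f v p = 0 ->
  (onl p v + (polar f p v == 0)%R + 2 <= d)%N.
Proof.
move=> p0 fp vp fv tv; apply: leq_trans (size_line_zero p0 fp vp).
have [v0 pv] := span_sym p0 vp.
rewrite addnAC leq_add2r onl_roots.
by rewrite card_roots_double ?line_neq0 ?line_coef0 ?line_coef1.
Qed.

Let card_span p : p != 0 -> #|span p| = q.
Proof.
move=> p0; rewrite card_imset // => s t /eqP.
by rewrite -subr_eq0 -scalerBl scaler_eq0 (negbTE p0) orbF subr_eq0 => /eqP.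
Qed.

Let cardV : #|{: 'rV[F]_3}| = (q ^ 3)%N.
Proof. by rewrite card_mx mul1n. Qed.

Let card_spanC p : p != 0 -> #|~: span p| = (q ^ 3 - q)%N.
Proof. by move=> p0; rewrite cardsCs setCK cardV card_span. Qed.

Let span0 p : 0 \in span p.
Proof. by apply/imsetP; exists 0; rewrite ?scale0r. Qed.

Let span_shift p v t : (v + t *: p \in span p) = (v \in span p).
Proof.
apply/imsetP/imsetP => -[s _ e].
  by exists (s - t) => //; rewrite scalerBl -e addrK.
by exists (s + t) => //; rewrite scalerDl e.
Qed.

(** The translations by the multiples of p permute the complement of the span of
   p, so each zero outside the span is counted q times. *)
Let sum_onl p : p != 0 -> f.@[p 0] = 0 ->
  (\sum_(v in ~: span p) onl p v + q * (q - 1) = q * #|zeros f|)%N.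
Proof.
move=> p0 fp.
have -> : #|zeros f| = (#|zeros f :\: span p| + (q - 1))%N.
  rewrite -(cardsID (span p) (zeros f)) addnC; congr (_ + _)%N.
  rewrite -(card_span p0) (cardsD1 0 (span p)) span0 add1n subn1 /=.
  apply: eq_card => v; rewrite !inE.
  case: eqP => //= v0; case: imsetP => [[t _ ->]|//]; rewrite ?andbF //.
  by rewrite (meval_homogZ hf) fp mulr0 eqxx.
rewrite mulnDr; congr (_ + _)%N.
under eq_bigr => v _ do rewrite /onl -sum1dep_card big_mkcond /=.
rewrite exchange_big /= -sum_nat_const; apply: eq_bigr => t _.
rewrite -big_mkcondr sum1dep_card.
rewrite -[LHS](card_imset _ (addIr (t *: p))); apply: eq_card => v.
apply/imsetP/setDP => [[w]|].
  rewrite !inE => /andP [wp fw] ->; rewrite span_shift fw andbT.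
  by split=> //; apply: contraNneq wp => wt0; rewrite -(span_shift p w t) wt0.
rewrite inE => -[/andP [v0 fv] vp]; exists (v - t *: p); last by rewrite subrK.
rewrite !inE subrK fv andbT.
by rewrite -(span_shift p _ t) subrK.
Qed.

(** The tangent directions at p form a linear subspace of codimension at most
   one, and p itself lies in it. *)
Let card_tangent p : p != 0 -> f.@[p 0] = 0 ->
  (q ^ 2 - q <= \sum_(v in ~: span p) (polar f p v == 0)%R)%N.
Proof.
move=> p0 fp; rewrite -big_mkcondr /= sum1_card.
have kerP : {morph polar f p : v w / v - w}.
  by move=> v w; rewrite polarD -scaleN1r polarZ mulN1r.
have := leq_card_fibers kerP; rewrite cardV -/q.
rewrite -(cardsID (span p)) => h.
have -> : #|[pred v in ~: span p | polar f p v == 0]| =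
          #|[set v | polar f p v == 0] :\: span p|.
  by apply: eq_card => v; rewrite !inE.
rewrite leq_subLR -(leq_pmul2l (ltnW q_gt1)) -expnS (leq_trans h) //.
by rewrite leq_mul2l leq_add2r -(card_span p0) subset_leq_card ?orbT ?subsetIr.
Qed.

Let sum_onl_tangent_le p : p != 0 -> f.@[p 0] = 0 ->
  (\sum_(v in ~: span p) (onl p v + (polar f p v == 0)%R) <=
   \sum_(v in ~: span p) (d - 1))%N.
Proof.
move=> p0 fp; apply: leq_sum => v; rewrite inE => vp.
by have := onl_lt p0 fp vp; lia.
Qed.

Let q3 : (q ^ 3 - q = q * (q ^ 2 - 1))%N.
Proof. by rewrite mulnBr muln1 -expnS. Qed.

(** Sum the bound of [onl_lt] over all v outside the span of a zero p. *)
Lemma card_zeros_le : (#|zeros f| <= (d - 1) * (q ^ 2 - 1))%N.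
Proof.
case: (set_0Vmem (zeros f)) => [->|[p]]; first by rewrite cards0.
rewrite inE => /andP [p0 /eqP fp].
have S := sum_onl p0 fp; have T := card_tangent p0 fp.
have := sum_onl_tangent_le p0 fp.
rewrite big_split sum_nat_const card_spanC //= => h.
rewrite -(leq_pmul2l (ltnW q_gt1)) -S.
have e2 : (q * (q - 1) = q ^ 2 - q)%N by rewrite mulnBr muln1.
have e3 : (q * ((d - 1) * (q ^ 2 - 1)) = (q ^ 3 - q) * (d - 1))%N.
  by rewrite q3 mulnCA mulnC.
by rewrite e3 e2 (leq_trans _ h) // leq_add2l.
Qed.

(** In the case of equality, the bound of [onl_lt] is sharp for every zero p and
   every direction. Since d >= 3, a tangent line at p carries another zero p'.
   As p is a double root on that line, sharpness at p' makes the line tangent at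
   p' too, and then [onl_double] contradicts sharpness at p. *)
Lemma card_zeros_neq : (3 <= d)%N -> #|zeros f| != ((d - 1) * (q ^ 2 - 1))%N.
Proof.
move=> d3; apply/eqP => N.
have tight p v : p != 0 -> f.@[p 0] = 0 -> v \notin span p ->
    (onl p v + (polar f p v == 0)%R = d - 1)%N.
  move=> p0 fp; have S := sum_onl p0 fp; have T := card_tangent p0 fp.
  rewrite -in_setC => vp.
  have le1 w : w \in ~: span p ->
      (onl p w + (polar f p w == 0)%R <= d - 1
        ?= iff (onl p w + (polar f p w == 0)%R == d - 1))%N.
    rewrite inE => wp; split=> //; have := onl_lt p0 fp wp; lia.
  have [_] := leqif_sum le1.
  have -> : (\sum_(i in ~: span p) (onl p i + (polar f p i == 0)%R) ==
             \sum_(i in ~: span p) (d - 1))%N.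
    rewrite eqn_leq sum_onl_tangent_le //= big_split sum_nat_const card_spanC //=.
    have -> : ((q ^ 3 - q) * (d - 1) = q * #|zeros f|)%N.
      by rewrite N mulnCA q3 mulnC.
    by rewrite -S leq_add2l mulnBr muln1.
  by move/esym/forall_inP => /(_ v vp) /eqP.
have d1 : (0 < d - 1)%N by rewrite subn_gt0 ltnW.
have [p p0 fp] : exists2 p : 'rV[F]_3, p != 0 & f.@[p 0] = 0.
  have /card_gt0P [p] : (0 < #|zeros f|)%N.
    by rewrite N muln_gt0 d1 subn_gt0 -{1}(exp1n 2) ltn_exp2r.
  by rewrite inE => /andP [p0 /eqP fp]; exists p.
have [v vp tv] : exists2 v, v \notin span p & polar f p v = 0.
  have [v /andP [vp /eqP tv]|h] :=
    pickP [pred v | (v \notin span p) && (polar f p v == 0)]; first by exists v.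
  have := card_tangent p0 fp; rewrite big1 => [|v]; last first.
    by rewrite inE => vp; have := h v; rewrite /= vp /= => ->.
  by rewrite leqNgt subn_gt0 -{1}(expn1 q) ltn_exp2l.
have [t ft] : exists t, f.@[(v + t *: p) 0] = 0.
  have /card_gt0P [t] : (0 < onl p v)%N.
    by have := tight p v p0 fp vp; rewrite tv eqxx; lia.
  by rewrite inE => /eqP ft; exists t.
(* p' is a zero other than p on a line that is tangent at p *)
set p' := v + t *: p in ft.
have pp' : p' \notin span p by rewrite span_shift.
have [p'0 p'p] := span_sym p0 pp'.
have tp' : polar f p p' = 0.
  by rewrite polarD polarZ (polar_self hf fp) mulr0 addr0.
(* p is a double zero on the line from p', so the line is tangent at p' *)
have := onl_double p'0 ft p'p fp tp'; have := tight p' p p'0 ft p'p.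
case: eqP => [e1 e2 _|_]; last by lia.
have := onl_double p0 fp pp' ft e1; have := tight p p' p0 fp pp'; lia.
Qed.
End Count.

(** * Zeros on the rational points of the plane *)

Definition proj_reps (F : fieldType) (n : nat) (p : 'I_n -> 'rV[F]_3) : Prop :=
  [/\ forall i, p i != 0,
      forall i j c, p i = c *: p j -> i = j
    & forall v, v != 0 -> exists i c, v = c *: p i].

Lemma zero_homog0 (F : fieldType) (n d : nat) (f : {mpoly F[n]}) (c : F)
    (x : 'rV[F]_n) :
  f \is d.-homog -> c != 0 -> (f.@[(c *: x) 0] == 0) = (f.@[x 0] == 0).
Proof.
by move=> hf c0; rewrite (meval_homogZ hf) mulf_eq0 expf_eq0 (negbTE c0) andbF.
Qed.

Section Points.
Context (F : finFieldType) (n : nat) (p : 'I_n -> 'rV[F]_3).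
Hypothesis hp : proj_reps p.
Let q := #|F|.
Let q_gt1 : (1 < q)%N. Proof. exact: finNzRing_gt1. Qed.

Definition pzeros (f : {mpoly F[3]}) : {set 'I_n} := [set i | f.@[p i 0] == 0].

Lemma card_zeros_pzeros (d : nat) (f : {mpoly F[3]}) :
  f \is d.-homog -> #|zeros f| = (#|pzeros f| * (q - 1))%N.
Proof.
move=> hf; have [p0 pinj psurj] := hp.
have -> : (q - 1)%N = #|[set c : F | c != 0]|.
  by rewrite subn1 -(cardC1 (0 : F)); apply: eq_card => c; rewrite !inE.
rewrite -cardsX -(@card_in_imset _ _ (fun ic => ic.2 *: p ic.1)).
  apply: eq_card => v; apply/idP/imsetP.
    rewrite inE => /andP [v0 fv]; have [i [c vE]] := psurj v v0.
    have c0 : c != 0 by apply: contraNneq v0 => c0; rewrite vE c0 scale0r.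
    by exists (i, c); rewrite // !inE c0 -(zero_homog0 _ hf c0) -vE fv.
  case=> -[i c]; rewrite !inE /= => /andP [fi c0] ->.
  by rewrite scaler_eq0 (negbTE c0) (negbTE (p0 i)) (zero_homog0 _ hf c0).
move=> [i c] [j e]; rewrite !inE /= => /andP [_ c0] /andP [_ e0] h.
have ij : i = j.
  by apply: (pinj i j (c^-1 * e)); rewrite -scalerA -h scalerA mulVf ?scale1r.
congr (_, _) => //; rewrite -ij in h.
by apply/eqP; rewrite -subr_eq0 -[_ == 0]orbF -(negbTE (p0 i)) -scaler_eq0
  scalerBl h subrr.
Qed.

Lemma card_proj_reps : n = (q ^ 2 + q + 1)%N.
Proof.
have h0 : (0 : {mpoly F[3]}) \is 0.-homog by exact: dhomog0.
have := card_zeros_pzeros h0.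
have -> : #|pzeros 0| = n.
  by rewrite -[RHS]card_ord; apply: eq_card => i; rewrite inE meval0 eqxx.
have -> : #|zeros (0 : {mpoly F[3]})| = (q ^ 3 - 1)%N.
  rewrite subn1 -[q]/(#|F|) -[3%N]/(1 * 3)%N -card_mx -(cardC1 (0 : 'rV[F]_3)).
  by apply: eq_card => v; rewrite !inE meval0 eqxx andbT.
move=> e; apply/eqP; rewrite -(@eqn_pmul2r (q - 1)) ?subn_gt0 // -e.
by apply/eqP; have := q_gt1; case: (q) => // k _; rewrite !expnS expn0; lia.
Qed.

Lemma card_pzeros_le (d : nat) (f : {mpoly F[3]}) :
  f \is d.-homog -> no_line f -> (#|pzeros f| <= (d - 1) * (q + 1))%N.
Proof.
move=> hf nf; have := card_zeros_le hf nf; rewrite (card_zeros_pzeros hf).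
have -> : (#|F| ^ 2 - 1 = (q + 1) * (q - 1))%N by rewrite (subn_sqr _ 1) mulnC.
by rewrite mulnA leq_pmul2r ?subn_gt0.
Qed.

Lemma card_pzeros_lt (d : nat) (f : {mpoly F[3]}) : (3 <= d)%N ->
  f \is d.-homog -> no_line f -> (#|pzeros f| < (d - 1) * (q + 1))%N.
Proof.
move=> d3 hf nf; rewrite ltn_neqAle card_pzeros_le // andbT.
have := card_zeros_neq hf nf d3; rewrite (card_zeros_pzeros hf).
have -> : (#|F| ^ 2 - 1 = (q + 1) * (q - 1))%N by rewrite (subn_sqr _ 1) mulnC.
by rewrite mulnA eqn_pmul2r ?subn_gt0.
Qed.

(** Translation by a basis vector on which r is not zero moves the zeros of r
   to q disjoint copies. *)
Lemma card_pzeros_linear_le (r : {mpoly F[3]}) :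
  r \is 1.-homog -> r != 0 -> (#|pzeros r| <= q + 1)%N.
Proof.
move=> hr r0; have [c rE] := homog1_lform hr.
rewrite -(@leq_pmul2r (q - 1)) ?subn_gt0 // -(card_zeros_pzeros hr).
have [j cj] : exists j, c j 0 != 0.
  apply/existsP; rewrite -negb_forall; apply: contra r0 => /forallP c0.
  by rewrite rE lform_eq0; apply/eqP/colP => j; rewrite mxE; apply/eqP/c0.
have phiE (v : 'rV[F]_3) t : r.@[(v + t *: delta_mx 0 j) 0] = r.@[v 0] + t * c j 0.
  rewrite rE !meval_lform mulmxDl mxE -scalemxAl; congr (_ + _).
  by rewrite mxE -rowE mxE.
pose Z := [set v : 'rV[F]_3 | r.@[v 0] == 0].
have cZ : (#|Z| * q <= q ^ 3)%N.
  rewrite -[q in (_ * q)%N]cardsT -cardsX -[leqRHS](card_mx F 1 3).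
  rewrite -(@card_in_imset _ _ (fun vt => vt.1 + vt.2 *: delta_mx 0 j)).
    exact: max_card.
  move=> [v t] [w s]; rewrite !inE !andbT /= => /eqP v0 /eqP w0 e.
  have ts : t = s.
    have := congr1 (fun x : 'rV[F]_3 => r.@[x 0]) e; rewrite !phiE v0 w0 !add0r.
    exact: (mulIf cj).
  by congr (_, _) => //; rewrite ts in e; apply: addIr e.
have ZE : #|Z| = #|zeros r|.+1.
  rewrite (cardsD1 0 Z) inE rE meval_lform mul0mx mxE eqxx add1n; congr _.+1.
  by apply: eq_card => v; rewrite !inE rE.
by move: cZ; rewrite ZE expnS [(q * _)%N]mulnC leq_pmul2r ?(ltnW q_gt1) //
  -[(q + 1)%N]/(q + 1)%N mulnC -(subn_sqr _ 1) exp1n; lia.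
Qed.

Lemma card_pzeros_linear_ge (r : {mpoly F[3]}) :
  r \is 1.-homog -> (q + 1 <= #|pzeros r|)%N.
Proof.
move=> hr; have [c rE] := homog1_lform hr.
rewrite -(@leq_pmul2r (q - 1)) ?subn_gt0 // -(card_zeros_pzeros hr).
pose phi (v : 'rV[F]_3) := v *m c.
have phiB : {morph phi : v w / v - w} by move=> v w; apply: mulmxBl.
have := leq_card_fibers phiB; rewrite !card_mx -/q expnS leq_pmul2l ?(ltnW q_gt1) //.
have -> : #|[set v | phi v == 0]| = #|zeros r|.+1.
  rewrite (cardsD1 0) inE /phi mul0mx eqxx add1n; congr _.+1.
  apply: eq_card => v; rewrite !inE rE meval_lform; congr (_ && _).
  apply/eqP/eqP => [->|h]; first by rewrite mxE.
  by apply/matrixP => i j; rewrite !ord1 h mxE.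
by rewrite [(_ * (q - 1))%N]mulnC -(subn_sqr _ 1) exp1n; lia.
Qed.

Lemma pzerosM (f g : {mpoly F[3]}) : pzeros (f * g) = pzeros f :|: pzeros g.
Proof. by apply/setP => i; rewrite !inE mevalM mulf_eq0. Qed.

(** Two linear forms in three variables have a common zero. *)
Lemma pzeros_meet (r s : {mpoly F[3]}) : r \is 1.-homog -> s \is 1.-homog ->
  (0 < #|pzeros r :&: pzeros s|)%N.
Proof.
move=> hr hs; have [_ _ psurj] := hp.
have [c rE] := homog1_lform hr; have [e sE] := homog1_lform hs.
pose phi (v : 'rV[F]_3) := row_mx (v *m c) (v *m e).
have phiB : {morph phi : v w / v - w}.
  by move=> v w; rewrite /phi !mulmxBl opp_row_mx add_row_mx.
have := leq_card_fibers phiB; rewrite !card_mx !mul1n -/q.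
rewrite expnSr leq_pmul2l ?expn_gt0 ?(ltnW q_gt1) // => ker.
have [v v0 /eqP] : exists2 v, v != 0 & phi v = 0.
  have [v /andP [v0 /eqP hv]|h] := pickP [pred v | (v != 0) && (phi v == 0)].
    by exists v.
  have : (#|[set v | phi v == 0%R]| <= #|[set (0%R : 'rV[F]_3)]|)%N.
    apply/subset_leq_card/subsetP => v; rewrite !inE => hv; apply/negPn/negP => v0.
    by have := h v; rewrite /= v0 hv.
  by rewrite cards1 leqNgt (leq_trans q_gt1).
rewrite row_mx_eq0 => /andP [/eqP vc /eqP ve].
have [i [t vE]] := psurj v v0.
have t0 : t != 0 by apply: contraNneq v0 => t0; rewrite vE t0 scale0r.
apply/card_gt0P; exists i; rewrite !inE -(zero_homog0 _ hr t0) -(zero_homog0 _ hs t0).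
by rewrite -vE rE sE !meval_lform vc ve mxE eqxx.
Qed.

(** The hypothesis on ev expresses that the point is on no rational line. Each
   linear factor can be removed without losing the zero of ev; the three possible
   outcomes are a quartic, a line and a cubic, or two lines and a conic, where the
   last factor contains no line. Four lines are impossible. *)
Lemma quartic_bound (L : idomainType) (ev : {rmorphism {mpoly F[3]} -> L})
    (f : {mpoly F[3]}) :
  (forall r, r \is 1.-homog -> r != 0 -> ev r != 0) ->
  f \is 4.-homog -> f != 0 -> ev f = 0 -> (#|pzeros f| <= 3 * q + 2)%N.
Proof.
move=> evl hf f0 evf.
have split_ d g : g \is d.+1.-homog -> g != 0 -> ev g = 0 ->
    (exists r c, [/\ [/\ r \is 1.-homog, r != 0 & ev r != 0],
       [/\ c \is d.-homog, c != 0 & ev c = 0] & g = r * c]) \/ no_line g.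
  move=> hg g0 evg; case: (linear_factor_or_no_line hg); last by right.
  case=> r [c [hr r0 gE]]; left; exists r, c.
  have er := evl r hr r0; split=> //; split.
  - by apply: (dhomog_factor hr r0); rewrite -gE add1n.
  - by apply: contraNneq g0; rewrite gE => ->; rewrite mulr0.
  - by apply: (mulfI er); rewrite mulr0 -rmorphM -gE.
have cardU (A B : {set 'I_n}) : (#|A :|: B| + #|A :&: B| = #|A| + #|B|)%N.
  by rewrite cardsU subnK // (leq_trans (subset_leq_card (subsetIl _ _))) ?leq_addr.
case: (split_ _ _ hf f0 evf) => [|nf]; last first.
  by have := @card_pzeros_lt 4 _ isT hf nf; lia.
case=> r [g [[hr r0 _] [hg g0 evg] ->]] {f f0 evf hf}.
have Nr := card_pzeros_linear_le hr r0.
rewrite pzerosM; have := cardU (pzeros r) (pzeros g).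
case: (split_ _ _ hg g0 evg) => [|ng]; last first.
  by have := @card_pzeros_lt 3 _ isT hg ng; lia.
case=> s [h [[hs s0 _] [hh h0 evh] ->]] {g g0 evg hg} _.
have Ns := card_pzeros_linear_le hs s0.
have := pzeros_meet hr hs; have := cardU (pzeros r) (pzeros s).
rewrite pzerosM setUA; have := cardU (pzeros r :|: pzeros s) (pzeros h).
case: (split_ _ _ hh h0 evh) => [|nh]; last first.
  by have := card_pzeros_le hh nh; lia.
case=> t [c [_ [hc c0 evc] _]]; exfalso.
by have := evl c hc c0; rewrite evc eqxx.
Qed.

End Points.

(** * A conic with two external lines *)

(** The map t^2 - t takes the value 0 twice, so it is not onto. This is uniform
   in the characteristic. *)
Lemma exists_irreducible_quadratic (F : finFieldType) :
  exists w : F, forall t : F, t ^+ 2 - t != w.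
Proof.
pose h (t : F) := t ^+ 2 - t.
have [w wh|onto] := pickP [pred w | w \notin codom h].
  by exists w => t; apply: contraNneq wh => <-; apply: codom_f.
have /image_injP inj : #|codom h| == #|F|.
  by apply/eqP/eq_card => w; have := onto w; rewrite /= => /negbFE ->.
have : (0 : F) = 1 by apply: inj; rewrite // /h expr2 mulr0 expr1n !subrr.
by move/eqP; rewrite eq_sym oner_eq0.
Qed.

Section Extremal.
Context (F : finFieldType) (n : nat) (p : 'I_n -> 'rV[F]_3).
Hypothesis hp : proj_reps p.
Let q := #|F|.
Hypothesis q_gt2 : (2 < q)%N.
Context (c : 'cV[F]_3).
Hypothesis c2 : c (inord 2) 0 != 0.

Let i1 : 'I_3 := 1.
Let i2 : 'I_3 := inord 2.
Let m (x : 'rV[F]_3) : F := (lform c).@[x 0].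

Let sum3 (R : nmodType) (h : 'I_3 -> R) : \sum_i h i = h 0 + h i1 + h i2.
Proof.
rewrite !big_ord_recl big_ord0 addr0 addrA; congr (_ + h _ + h _).
  exact/val_inj.
by apply/val_inj; rewrite /= inordK.
Qed.

Let mE x : m x = x 0 0 * c 0 0 + x 0 i1 * c i1 0 + x 0 i2 * c i2 0.
Proof. by rewrite /m meval_lform mxE sum3. Qed.

Let ext (x y : 'rV[F]_3) : x 0 0 = y 0 0 -> x 0 i1 = y 0 i1 -> m x = m y -> x = y.
Proof.
move=> e0 e1; rewrite !mE e0 e1 => /addrI /(mulIf c2) e2.
apply/rowP => -[[|[|[|//]]] h].
- by rewrite (_ : Ordinal h = 0) //; apply/val_inj.
- by rewrite (_ : Ordinal h = i1) //; apply/val_inj.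
- by rewrite (_ : Ordinal h = i2) //; apply/val_inj; rewrite /= inordK.
Qed.

Let vec (s t u : F) : 'rV[F]_3 :=
  \row_i (if i == 0 then s else if i == i1 then t
          else (u - s * c 0 0 - t * c i1 0) / c i2 0).

Let vecP s t u : [/\ vec s t u 0 0 = s, vec s t u 0 i1 = t & m (vec s t u) = u].
Proof.
have i20 : (i2 == 0) = false by rewrite -val_eqE /= inordK.
have i21 : (i2 == i1) = false by rewrite -val_eqE /= inordK.
by rewrite mE !mxE /= i20 i21 divfK //; split=> //; ring.
Qed.

Definition conic : {mpoly F[3]} := 'X_0 * lform c - 'X_i1 ^+ 2.

(** On the conic, parametrized by X_0 : X_1 : m = s^2 : s t : t^2, this linear
   form restricts to t^2 - r s t - r^2 w s^2, which has no rational zero when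
   X^2 - X - w has none. *)
Definition ext_line (r w : F) : {mpoly F[3]} :=
  lform c - r *: 'X_i1 - (r ^+ 2 * w) *: 'X_0.

Let conicE (x : 'rV[F]_3) : conic.@[x 0] = x 0 0 * m x - x 0 i1 ^+ 2.
Proof. by rewrite mevalB mevalM rmorphXn /= !mevalXU. Qed.

Let ext_lineE r w (x : 'rV[F]_3) :
  (ext_line r w).@[x 0] = m x - r * x 0 i1 - r ^+ 2 * w * x 0 0.
Proof. by rewrite !mevalB !mevalZ !mevalXU. Qed.

Lemma conic_homog : conic \is 2.-homog.
Proof.
rewrite rpredB ?homogX //; apply: (dhomogM (homogX1 F _)); exact: lform_homog.
Qed.

Lemma ext_line_homog r w : ext_line r w \is 1.-homog.
Proof. by rewrite !rpredB ?rpredZ ?homogX1 ?lform_homog. Qed.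

Let card_conic : (q + 1 <= #|pzeros p conic|)%N.
Proof.
have q1 : (0 < q - 1)%N by rewrite subn_gt0 ltnW.
rewrite -(leq_pmul2r q1) -(card_zeros_pzeros hp conic_homog).
pose D := ~: [set (0 : F * F)].
have cD : #|D| = ((q + 1) * (q - 1))%N.
  by rewrite cardsC1 card_prod mulnC -(subn_sqr _ 1) exp1n subn1 mulnn.
(* the parametrization by s : t, with (0, t) sent to the multiples of the point
   at infinity 0 : 0 : 1, so that it is injective on vectors *)
pose pt (st : F * F) :=
  if st.1 == 0 then vec 0 0 st.2 else vec st.1 st.2 (st.2 ^+ 2 / st.1).
rewrite -cD -(@card_in_imset _ _ pt).
  apply/subset_leq_card/subsetP => _ /imsetP [[s t] st0 ->].
  rewrite /pt /=; case: eqP => [s0|/eqP s0]; rewrite inE conicE.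
    have [-> -> mv] := vecP 0 0 t; rewrite mul0r expr0n subrr eqxx andbT.
    move: st0; rewrite !inE s0; apply: contraNneq => v0.
    by rewrite -mv v0 /m meval_lform mul0mx mxE.
  have [e0 -> ->] := vecP s t (t ^+ 2 / s).
  rewrite e0 mulrCA divff // mulr1 subrr eqxx andbT.
  by apply: contraNneq s0 => v0; rewrite -e0 v0 mxE.
move=> [s t] [s' t'] _ _; rewrite /pt /=.
have vE x y z x' y' z' : vec x y z = vec x' y' z' -> [/\ x = x', y = y' & z = z'].
  have [a1 a2 a3] := vecP x y z; have [b1 b2 b3] := vecP x' y' z'.
  by move=> e; move: a1 a2 a3; rewrite e b1 b2 b3.
case: eqP => [->|s0]; case: eqP => [->|s'0] /vE [e1 e2 e3].
- by rewrite e3.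
- by case: s'0.
- by case: s0.
- by rewrite e1 e2.
Qed.

Let conic_disjoint (r w : F) : r != 0 -> (forall t, t ^+ 2 - t != w) ->
  pzeros p conic :&: pzeros p (ext_line r w) = set0.
Proof.
move=> r0 hw; have [p0 _ _] := hp.
apply/setP => i; rewrite !inE conicE ext_lineE; apply/negP => /andP [/eqP C /eqP L].
have [x0|x0] := eqVneq (p i 0 0) 0.
  have x1 : p i 0 i1 = 0.
    by move/eqP: C; rewrite x0 mul0r sub0r oppr_eq0 expf_eq0 => /eqP.
  move/eqP: (p0 i); apply; apply: ext; rewrite ?x0 ?x1 ?mxE //.
  move: L; rewrite x0 x1 !mulr0 !subr0 => ->.
  by rewrite /m meval_lform mul0mx mxE.
have /eqP := hw (p i 0 i1 / (r * p i 0 0)); apply.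
have mx : m (p i) = p i 0 i1 ^+ 2 / p i 0 0.
  by apply: (mulfI x0); rewrite mulrCA divff // mulr1; apply/eqP; rewrite -subr_eq0 C.
have {L} L : r ^+ 2 * w * p i 0 0 = p i 0 i1 ^+ 2 / p i 0 0 - r * p i 0 i1.
  by rewrite -mx; apply/eqP; rewrite -subr_eq0 -oppr_eq0 opprB L.
apply: (mulfI (expf_neq0 2 r0)); apply: (mulIf x0); rewrite L; field.
by rewrite x0 r0.
Qed.

Let lines_meet (r w : F) : r != 1 ->
  (#|pzeros p (ext_line 1%R w) :&: pzeros p (ext_line r w)| <= 1)%N.
Proof.
move=> r1; have [p0 pinj _] := hp.
have r1' : 1 - r != 0 by rewrite subr_eq0 eq_sym.
have coords i : i \in pzeros p (ext_line 1 w) :&: pzeros p (ext_line r w) ->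
    p i 0 i1 = - ((1 + r) * w) * p i 0 0 /\ m (p i) = - (r * w) * p i 0 0.
  rewrite !inE !ext_lineE => /andP [/eqP L1 /eqP L2].
  have x1 : p i 0 i1 = - ((1 + r) * w) * p i 0 0.
    apply: (mulfI r1'); apply/eqP; rewrite -subr_eq0; apply/eqP.
    by rewrite -[RHS]subr0 -{1}L2 -L1; ring.
  split=> //; apply/eqP; rewrite -subr_eq0; apply/eqP; rewrite -[RHS]L1 x1; ring.
apply/card_le1_eqP => i j /coords [ei fi] /coords [ej fj].
have nz k : p k 0 i1 = - ((1 + r) * w) * p k 0 0 -> m (p k) = - (r * w) * p k 0 0 ->
    p k 0 0 != 0.
  move=> e f; apply: contraNneq (p0 k) => x0; apply/eqP/ext; rewrite ?mxE //.
    by rewrite e x0 mulr0.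
  by rewrite f x0 mulr0 /m meval_lform mul0mx mxE.
apply/esym; apply: (pinj i j (p i 0 0 / p j 0 0)).
have z := nz _ ej fj.
apply: ext.
- by rewrite mxE divfK.
- by rewrite mxE ei ej mulrCA divfK.
have -> : m ((p i 0 0 / p j 0 0) *: p j) = p i 0 0 / p j 0 0 * m (p j).
  by rewrite /m !meval_lform -scalemxAl mxE.
by rewrite fi fj mulrCA divfK.
Qed.

(** The conic and the two lines have q + 1 points each, and only the lines meet,
   in at most one point. *)
Lemma conic_two_external_lines : exists l1 l2,
  [/\ l1 \is 1.-homog, l2 \is 1.-homog, conic * (l1 * l2) != 0
    & (3 * q + 2 <= #|pzeros p (conic * (l1 * l2))|)%N].
Proof.
have [w hw] := exists_irreducible_quadratic F.
have [r r0 r1] : exists2 r : F, r != 0 & r != 1.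
  have [r /andP [r0 r1]|h] := pickP [pred r : F | (r != 0) && (r != 1)].
    by exists r.
  have : (#|F| <= #|[set 0%R; 1%R : F]|)%N.
    apply/subset_leq_card/subsetP => r _; rewrite !inE.
    by apply/negPn; rewrite negb_or; have /= -> := h r.
  by rewrite cards2 leqNgt (leq_ltn_trans _ q_gt2) // ltnS leq_b1.
exists (ext_line 1 w), (ext_line r w); split; try exact: ext_line_homog.
  have line0 t : ext_line t w != 0.
    apply: contraTneq isT => e; have := ext_lineE t w (vec 0 0 1).
    have [-> -> ->] := vecP 0 0 1; rewrite e meval0 !mulr0 !subr0 => /eqP.
    by rewrite eq_sym oner_eq0.
  rewrite !mulf_neq0 //; apply: contraTneq isT => e; have := conicE (vec 0 1 0).
  have [-> -> ->] := vecP 0 1 0; rewrite e meval0 mul0r sub0r expr1n => /eqP.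
  by rewrite eq_sym oppr_eq0 oner_eq0.
rewrite !pzerosM; set C := pzeros p conic.
set A := pzeros p (ext_line 1 w); set B := pzeros p (ext_line r w).
have CA : C :&: A = set0 by apply: conic_disjoint; rewrite ?oner_neq0.
have CB : C :&: B = set0 by apply: conic_disjoint.
have cA : (q + 1 <= #|A|)%N := card_pzeros_linear_ge hp (ext_line_homog 1 w).
have cB : (q + 1 <= #|B|)%N := card_pzeros_linear_ge hp (ext_line_homog r w).
rewrite cardsU setIUr CA CB setU0 cards0 subn0 cardsU.
have := lines_meet w r1; rewrite -/A -/B; have := card_conic; rewrite -/C; lia.
Qed.

End Extremal.

(** * Forms through irrational points *)

(** Adding 1 to all elements of F does not change their sum. *)
Lemma nat_card_eq0 (F : finFieldType) : #|F|%:R = 0 :> F.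
Proof.
apply: (addrI (\sum_(c : F) c)); rewrite addr0 -sumr_const -big_split /=.
by rewrite [RHS](reindex_inj (addIr 1)).
Qed.

(** The quotient of X^(q^m) - X by X^q - X. Since X^(q^m) - X has derivative -1,
   its roots are simple: those of F are removed by the division and those outside
   F are simple roots of the quotient. *)
Lemma separating_poly (F : finFieldType) (K : fieldExtType F) (m : nat) :
  (0 < m)%N ->
  exists s : {poly F}, [/\ s \is monic,
    forall c, s.[c] != 0
  & forall z : K, z ^+ (#|F| ^ m) = z -> z \notin 1%VS ->
      root (map_poly (in_alg K) s) z /\
      (map_poly (in_alg K) s)^`().[z] != 0].
Proof.
move=> m0; set Q := (#|F| ^ m)%N.
have q_gt1 : (1 < #|F|)%N by exact: finNzRing_gt1.
have Q_gt1 : (1 < Q)%N by rewrite -(exp1n m) ltn_exp2r.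
have expQ c : c ^+ Q = c :> F.
  by rewrite /Q; elim: (m) => // k IH; rewrite expnSr exprM IH expf_card.
have derQ : ('X^Q - 'X : {poly F})^`() = - 1.
  rewrite derivB derivXn derivX -mulr_natr -polyC_natr.
  by rewrite /Q -(prednK m0) expnS natrM nat_card_eq0 mul0r mulr0 sub0r.
have dvd : ('X^#|F| - 'X : {poly F}) %| 'X^Q - 'X.
  rewrite finField_genPoly -big_enum; apply: uniq_roots_dvdp.
    by apply/allP => c _; rewrite rootE !hornerE expQ subrr.
  by rewrite uniq_rootsE enum_uniq.
have monicX k : (1 < k)%N -> ('X^k - 'X : {poly F}) \is monic.
  move=> k1; rewrite monicE lead_coefDl ?lead_coefXn //.
  by rewrite size_polyN size_polyX size_polyXn.
pose s := ('X^Q - 'X : {poly F}) %/ ('X^#|F| - 'X).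
have sE : 'X^Q - 'X = s * ('X^#|F| - 'X) by rewrite divpK.
exists s; split.
- by rewrite -(monicMr _ (monicX _ q_gt1)) -sE monicX.
- move=> c; have := congr1 (fun p : {poly F} => p^`().[c]) sE.
  rewrite derQ derivM !hornerE expf_card subrr mulr0 add0r => e.
  by apply: contra_eqN e => /eqP ->; rewrite mul0r oppr_eq0 oner_eq0.
move=> z zQ zF.
have zq : z ^+ #|F| - z != 0.
  rewrite subr_eq0; apply: contra zF.
  by have := Fermat's_little_theorem (1%AS : {subfield K}) z; rewrite dimv1 expn1 => ->.
pose g := map_poly (in_alg K).
have gE k : g ('X^k - 'X) = 'X^k - 'X.
  by rewrite /g rmorphB /= map_polyXn map_polyX.
have sgE : 'X^Q - 'X = g s * ('X^#|F| - 'X).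
  by rewrite -!gE -rmorphM -sE.
have sz : (g s).[z] = 0.
  have := congr1 (horner^~ z) sgE; rewrite !hornerE zQ subrr => /esym/eqP.
  by rewrite mulf_eq0 (negbTE zq) orbF => /eqP.
split; first by rewrite rootE -/g sz.
have := congr1 (fun p : {poly K} => p^`().[z]) sgE.
have -> : ('X^Q - 'X : {poly K})^`() = - 1.
  by rewrite -gE /g deriv_map derQ rmorphN rmorph1.
rewrite derivM !hornerE sz mul0r addr0 => e.
by apply: contra_eqN e => /eqP ->; rewrite mul0r oppr_eq0 oner_eq0.
Qed.

(** If z and r are quotient and remainder of y by b, then (x - z c) b = r c; the
   degree of r is less than that of b, so both sides are zero. *)
Lemma monic_cancel_dvd (R : idomainType) (b x y : {poly R}) (c : R) :
  b \is monic -> x * b = y * c%:P -> exists z, x = z * c%:P.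
Proof.
move=> bm e; have b0 := monic_neq0 bm.
exists (Pdiv.Ring.rdivp y b); apply/eqP; rewrite -subr_eq0; apply/negPn/negP => n0.
have h : (x - Pdiv.Ring.rdivp y b * c%:P) * b = Pdiv.Ring.rmodp y b * c%:P.
  rewrite mulrBl e {1}(Pdiv.RingMonic.rdivp_eq bm y); ring.
have := size_mul n0 b0; rewrite h.
have : (size (Pdiv.Ring.rmodp y b * c%:P)%R <= size (Pdiv.Ring.rmodp y b))%N.
  rewrite mulrC mul_polyC; exact: size_scale_leq.
have := Pdiv.Ring.ltn_rmodpN0 y b0.
have : (0 < size (x - Pdiv.Ring.rdivp y b * c%:P)%R)%N by rewrite size_poly_gt0.
by move: (size _) (size _) (size _) (size _) => *; lia.
Qed.

(** The form in X_i and X_0 whose dehomogenization is s. *)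
Definition homogenize (F : fieldType) (s : {poly F}) (i : 'I_3) : {mpoly F[3]} :=
  \sum_(k < size s) s`_k *: ('X_i ^+ k * 'X_0 ^+ ((size s).-1 - k)).

Lemma homogenize_homog (F : fieldType) (s : {poly F}) i :
  homogenize s i \is (size s).-1.-homog.
Proof.
apply: rpred_sum => k _; apply: rpredZ.
rewrite -{2}(subnKC (_ : k <= (size s).-1)%N); first by apply: dhomogM; apply: homogX.
by rewrite -ltnS (leq_trans (ltn_ord k)) // leqSpred.
Qed.

Lemma mmap_homogenize (F : fieldType) (S : comNzRingType)
    (g : {rmorphism F -> S}) (x : 'I_3 -> S) (s : {poly F}) i :
  mmap g x (homogenize s i) =
  \sum_(k < size s) g s`_k * (x i ^+ k * x 0 ^+ ((size s).-1 - k)).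
Proof.
rewrite raddf_sum; apply: eq_bigr => k _ /=.
by rewrite mmapZ rmorphM !rmorphXn /= !mmapX !mmap1U.
Qed.

Lemma mmap_homogenize_ratio (F : fieldType) (S : comNzRingType)
    (g : {rmorphism F -> S}) (x : 'I_3 -> S) (y : S) (s : {poly F}) i :
  x i = x 0 * y ->
  mmap g x (homogenize s i) = x 0 ^+ (size s).-1 * (map_poly g s).[y].
Proof.
move=> xi; rewrite mmap_homogenize.
rewrite (@horner_coef_wide _ (size s)) ?size_poly // mulr_sumr.
apply: eq_bigr => k _; rewrite coef_map xi exprMn.
rewrite -{2}(subnKC (_ : k <= (size s).-1)%N) ?exprD; first ring.
by rewrite -ltnS (leq_trans (ltn_ord k)) // leqSpred.
Qed.

Lemma meval_homogenize_neq0 (F : fieldType) (s : {poly F}) i (x : 'rV[F]_3) :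
  s \is monic -> (forall c, s.[c] != 0) -> (x 0 0 != 0) || (x 0 i != 0) ->
  (homogenize s i).@[x 0] != 0.
Proof.
move=> sm s0 x0; pose g : {rmorphism F -> F} := idfun.
rewrite -[meval _ _]/(mmap g (x 0) (homogenize s i)).
have [x00|x00] := eqVneq (x 0 0) 0; last first.
  rewrite (@mmap_homogenize_ratio _ _ g _ (x 0 i / x 0 0)).
    by rewrite mulf_neq0 ?expf_neq0 // map_poly_id.
  by rewrite mulrCA divff ?mulr1.
rewrite x00 eqxx /= in x0.
rewrite mmap_homogenize x00.
have /prednK sE : (0 < size s)%N by rewrite size_poly_gt0 monic_neq0.
rewrite -sE big_ord_recr /= subnn expr0 mulr1.
rewrite big1 => [|k _]; last first.
  by rewrite expr0n subn_eq0 leqNgt ltn_ord !mulr0.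
by rewrite add0r -lead_coefE (monicP sm) mul1r expf_neq0.
Qed.

(** * The ideal of a point and its powers *)

Section PointIdeal.
Context (F : fieldType) (K : fieldExtType F) (a : 'I_3 -> K).
Implicit Types f g r : {mpoly F[3]}.
Local Notation I := (point_ideal a).
Local Notation ev := (mmap (in_alg K) a).

Lemma evalK_mmap f : evalK a f = ev f.
Proof.
rewrite /evalK /map_mpoly.
pose g : {rmorphism F -> {mpoly K[3]}} := @mpolyC 3 K \o in_alg K.
rewrite -[mmap _ _ f]/(mmap g (fun i => 'X_i) f) rmorph_mmap_comp.
by apply: eq_mmap => [c|i] /=; rewrite ?mevalC ?mevalXU.
Qed.

Lemma point_ideal_eval f : I f -> ev f = 0.
Proof.
move=> If; rewrite (pihomog_partitionE (leqnn (msize f))) raddf_sum big1 // => d _.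
by have /= := If d; rewrite evalK_mmap.
Qed.

Lemma point_ideal_homog d f : f \is d.-homog -> ev f = 0 -> I f.
Proof.
move=> hf f0 k; rewrite evalK_mmap; have [<-|dk] := eqVneq d k.
  by rewrite pihomog_dE.
by rewrite (pihomog_ne0 dk hf) mmap0.
Qed.

Lemma point_idealD f g : I f -> I g -> I (f + g).
Proof.
by move=> If Ig d; have := If d; have := Ig d; rewrite !evalK_mmap raddfD
  /= mmapD => -> ->; rewrite addr0.
Qed.

(** The ideal is defined by its homogeneous components, so the product is
   expanded into products of components. *)
Lemma point_idealM f g : I f -> I (g * f).
Proof.
move=> If; rewrite (pihomog_partitionE (leqnn (msize g))).
rewrite [in I _](pihomog_partitionE (leqnn (msize f))) mulr_suml.
elim/big_ind: _ => [||i _].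
- by move=> d; rewrite raddf0 evalK_mmap mmap0.
- exact: point_idealD.
rewrite mulr_sumr; elim/big_ind: _ => [||j _].
- by move=> d; rewrite raddf0 evalK_mmap mmap0.
- exact: point_idealD.
apply: (@point_ideal_homog (i + j)).
  by apply: dhomogM; apply: pihomogP.
by rewrite rmorphM /=; have := If j; rewrite evalK_mmap => ->; rewrite mulr0.
Qed.

Lemma ideal_powMl n f g : ideal_pow I n f -> ideal_pow I n (g * f).
Proof.
move=> h; elim: h g => {n f} [f|n f h If Ih IHh|n f h _ IHf _ IHh] g.
- exact: ideal_pow0.
- by rewrite mulrA; apply: ideal_powM => //; apply: point_idealM.
- by rewrite mulrDr; apply: ideal_powD.
Qed.

Lemma ideal_pow1 f : I f -> ideal_pow I 1 f.
Proof. by move=> If; rewrite -[f]mulr1; apply: ideal_powM => //; constructor. Qed.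

Lemma ideal_pow_exp n f : I f -> ideal_pow I n (f ^+ n).
Proof.
move=> If; elim: n => [|n IH]; first exact: ideal_pow0.
by rewrite exprS; apply: ideal_powM.
Qed.

Lemma horner0_mmap_line (b : 'I_3 -> K) f :
  (mmap (polyC \o in_alg K) (fun i => (a i)%:P + b i *: 'X) f).[0] = ev f.
Proof.
pose gK : {rmorphism F -> {poly K}} := polyC \o in_alg K.
rewrite -[mmap _ _ _]/(mmap gK _ f) -horner_evalE rmorph_mmap_comp.
apply: eq_mmap => [c|i] /=; first by rewrite horner_evalE hornerC.
by rewrite horner_evalE !hornerE.
Qed.

(** Elements of the n-th power of the ideal vanish to order n at the point, here
   along the line with direction b. *)
Lemma ideal_pow_dvdXn (b : 'I_3 -> K) n f : ideal_pow I n f ->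
  exists D, mmap (polyC \o in_alg K) (fun i => (a i)%:P + b i *: 'X) f
            = D * 'X^n.
Proof.
pose gK : {rmorphism F -> {poly K}} := polyC \o in_alg K.
pose x i := (a i)%:P + b i *: 'X : {poly K}.
rewrite -/x -[polyC \o in_alg K]/(gK : F -> {poly K}).
elim => {n f} [f|n f g If _ [D eD]|n f g _ [D eD] _ [E eE]].
- by eexists; rewrite expr0 mulr1.
- have [C eC] : exists C, mmap gK x f = C * 'X.
    have /factor_theorem [C ->] : root (mmap gK x f) 0.
      by apply/rootP; rewrite horner0_mmap_line point_ideal_eval.
    by exists C; rewrite subr0.
  by exists (C * D); rewrite rmorphM /= eD exprS eC; ring.
- by exists (D + E); rewrite mmapD eD eE mulrDl.
Qed.

End PointIdeal.

(** * Global sections on the blow-up *)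

(** Through phi, A becomes a constant and B a monic polynomial, which is not a zero
   divisor modulo a constant; the retraction brings the quotient back to R. *)
Lemma retract_cancel (R : idomainType) (phi : {rmorphism R -> {poly R}})
    (x A B u w : R) (N M : nat) :
  (forall f, (phi f).[x] = f) -> phi A = A%:P -> phi B \is monic ->
  u * B ^+ M = w * A ^+ N -> exists f, u = f * A ^+ N.
Proof.
move=> phiK phiA phiB /(congr1 phi); rewrite !rmorphM !rmorphXn /= phiA => e.
have [z zE] : exists z, phi u = z * (A ^+ N)%:P.
  by apply: (monic_cancel_dvd (monic_exp M phiB)); rewrite polyC_exp; exact: e.
by exists z.[x]; rewrite -[LHS]phiK zE hornerM hornerC.
Qed.

Section CubicPoint.
Context (F : finFieldType) (K : fieldExtType F) (a : 'I_3 -> K).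
Hypothesis hline : ~ on_rational_line a.
Implicit Types f g r : {mpoly F[3]}.
Local Notation I := (point_ideal a).
Local Notation ev := (mmap (in_alg K) a).

Lemma ev_linear_neq0 r : r \is 1.-homog -> r != 0 -> ev r != 0.
Proof.
move=> hr r0; apply/negP => /eqP er; apply: hline.
by exists r; split=> //; apply: point_ideal_homog hr er.
Qed.

Lemma ev_lform (c : 'cV[F]_3) : ev (lform c) = \sum_i c i 0 *: a i.
Proof.
rewrite raddf_sum; apply: eq_bigr => i _ /=.
by rewrite mmapZ mmapX mmap1U mulr_algl.
Qed.

Lemma coord_neq0 i : a i != 0.
Proof.
by have := ev_linear_neq0 (homogX1 _ i) (mpolyX_neq0 _ i); rewrite mmapX mmap1U.
Qed.

(** Otherwise the point is on the line X_i = c X_0. *)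
Lemma coord_ratio_irrational i : i != 0 -> a i / a 0 \notin 1%VS.
Proof.
move=> i0; apply/negP => /vlineP [c e].
pose r : {mpoly F[3]} := 'X_i - c *: 'X_0.
have r0 : r != 0.
  apply: contra_neq (oner_neq0 F) => /(congr1 (mcoeff U_(i))).
  rewrite /r mcoeffB mcoeffZ !mcoeffX eqxx eq_mnm1 eq_sym (negbTE i0) mulr0 subr0.
  by rewrite mcoeff0.
have hr : r \is 1.-homog by rewrite rpredB ?rpredZ ?homogX1.
move: (ev_linear_neq0 hr r0); rewrite /r mmapB mmapZ !mmapX !mmap1U.
by rewrite -{1}(divfK (coord_neq0 0) (a i)) e subrr eqxx.
Qed.

Hypothesis hdeg : point_degree a = 3%N.

Lemma coord_ratio_residue i j : a i / a j \in residue_field a.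
Proof.
apply: seqv_sub_adjoin; apply/mapP.
by exists (i, j) => //; rewrite mem_enum.
Qed.

Lemma coord_ratio_pow i : (a i / a 0) ^+ (#|F| ^ 3) = a i / a 0.
Proof.
have := Fermat's_little_theorem
  (<<1 & [seq a ij.1 / a ij.2 | ij : 'I_3 * 'I_3]>>%AS) (a i / a 0).
have -> : (a i / a 0 \in <<1 & [seq a ij.1 / a ij.2 | ij : 'I_3 * 'I_3]>>%AS).
  exact: coord_ratio_residue.
by rewrite -[X in (_ ^ X)%N]/(point_degree a) hdeg => /esym/eqP.
Qed.

(** The homogenization of [separating_poly] in X_i and X_0 belongs to the ideal
   and has a simple zero at the point in the direction of X_i. As s has no root in
   F, it also separates the point from the rational points
   ([meval_homogenize_neq0]). *)
Lemma separating_forms : exists s : {poly F},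
  [/\ s \is monic, forall c, s.[c] != 0 & forall i, i != 0 ->
     I (homogenize s i) /\ exists2 C : {poly K}, C.[0] != 0 &
       mmap (polyC \o in_alg K) (fun j => (a j)%:P + (j == i)%:R *: 'X)
         (homogenize s i) = 'X * C].
Proof.
have [s [sm s0 sK]] := @separating_poly F K 3 isT.
exists s; split=> // i i0.
have [rt der] := sK _ (coord_ratio_pow i) (coord_ratio_irrational i0).
have a0 := coord_neq0 0.
split.
  apply: point_ideal_homog (homogenize_homog s i) _.
  rewrite (@mmap_homogenize_ratio _ _ _ _ (a i / a 0)); last first.
    by rewrite mulrCA divff ?mulr1.
  by rewrite (rootP rt) mulr0.
pose gK : {rmorphism F -> {poly K}} := polyC \o in_alg K.
pose L := (a i / a 0)%:P + (a 0)^-1 *: 'X : {poly K}.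
have /factor_theorem [D DE] := rt.
exists ((a 0 ^+ (size s).-1)%:P * (a 0)^-1%:P * (D \Po L)).
  rewrite DE derivM derivXsubC mulr1 !hornerE subrr mulr0 add0r in der.
  by rewrite !hornerE horner_comp !hornerE !mulf_neq0 ?invr_neq0 ?expf_neq0.
rewrite -[polyC \o _]/(gK : F -> {poly K}).
rewrite (@mmap_homogenize_ratio _ _ gK _ L) /=; last first.
  rewrite eqxx eq_sym (negbTE i0) scale0r addr0 scale1r /L mulrDr -polyCM.
  by rewrite mulrCA divff // mulr1 -mul_polyC mulrA -polyCM divff // mul1r.
have -> : (map_poly gK s).[L] = (map_poly (in_alg K) s) \Po L.
  by rewrite /comp_poly -map_poly_comp.
have Lz : L - (a i / a 0)%:P = (a 0)^-1%:P * 'X.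
  by rewrite /L addrAC subrr add0r mul_polyC.
rewrite DE rmorphM rmorphB /= comp_polyX comp_polyC Lz.
rewrite eq_sym (negbTE i0) scale0r addr0 rmorphXn /=; ring.
Qed.

(** phi replaces X_j by a new indeterminate; evaluation at X_j is a retraction. *)
Lemma chart_morphism (i j : 'I_3) (s : {poly F}) :
  i != j -> i != 0 -> j != 0 -> s \is monic ->
  exists phi : {rmorphism {mpoly F[3]} -> {poly {mpoly F[3]}}},
    [/\ forall f, (phi f).['X_j] = f,
        phi ('X_i * homogenize s i) = ('X_i * homogenize s i)%:P
      & phi ('X_j * homogenize s j) \is monic].
Proof.
move=> ij i0 j0 sm.
pose X (k : 'I_3) : {poly {mpoly F[3]}} := if k == j then 'X else ('X_k)%:P.
pose gP : {rmorphism F -> {poly {mpoly F[3]}}} := polyC \o @mpolyC 3 F.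
have phiX k : mmap gP X 'X_k = X k by rewrite mmapX mmap1U.
exists (mmap gP X); split=> [f||].
- rewrite -horner_evalE rmorph_mmap_comp -[RHS]mmap_mpolyX.
  apply: eq_mmap => [c|k] /=; rewrite horner_evalE ?hornerC // /X.
  by case: eqP => [->|_]; rewrite ?hornerX ?hornerC.
- rewrite rmorphM /= phiX mmap_homogenize /X /= (negbTE ij) eq_sym (negbTE j0).
  rewrite polyCM; congr (_ * _); rewrite rmorph_sum; apply: eq_bigr => k _ /=.
  by rewrite -mul_mpolyC !polyCM !polyC_exp.
- rewrite rmorphM /= phiX mmap_homogenize /X /= eqxx eq_sym (negbTE j0).
  rewrite monicMl ?monicX // (_ : \sum_(k < _) _ = \poly_(k < size s)
    ((s`_k)%:MP_[3] * 'X_0 ^+ ((size s).-1 - k))); last first.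
    rewrite poly_def; apply: eq_bigr => k _.
    by rewrite -mul_polyC polyCM polyC_exp mulrCA mulrC.
  have lc : s`_(size s).-1 = 1 by rewrite -lead_coefE (monicP sm).
  rewrite monicE lead_coef_poly ?size_poly_gt0 ?monic_neq0 //.
    by rewrite lc subnn expr0 mulr1.
  by rewrite lc subnn expr0 mulr1 oner_neq0.
Qed.

(** The two charts of X_1 and X_2 and the forms of [separating_forms] suffice:
   they give A and B such that h A^N and h B^M are polynomials, so h is a
   polynomial f by [retract_cancel]. As f A^N lies in the power N + 1 of the ideal
   and A has a simple zero at the point, f vanishes there. *)
Lemma global_section_ideal m h :
  global_section I m 1 h <->
  exists f, [/\ f \is m.-homog, I f & h = tofrac f].
Proof.
split=> [H|[f [hf If ->]] d l g hl hg Ig]; last first.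
  exists 0%N, f; split.
  - by rewrite mul0n addn0.
  - exact: ideal_pow1.
  - by rewrite expr0 rmorph1 mulr1.
have [s [sm s0 sI]] := separating_forms.
pose i1 : 'I_3 := inord 1; pose i2 : 'I_3 := inord 2.
have i10 : i1 != 0 by rewrite -val_eqE /= inordK.
have i20 : i2 != 0 by rewrite -val_eqE /= inordK.
have i12 : i1 != i2 by rewrite -val_eqE /= !inordK.
have [I1 [C C0 CE]] := sI _ i10; have [I2 _] := sI _ i20.
have [N [u [hu Iu hE]]] := H _ _ _ (homogX1 _ i1) (homogenize_homog s i1) I1.
have [M [w [_ _ hE']]] := H _ _ _ (homogX1 _ i2) (homogenize_homog s i2) I2.
set A := 'X_i1 * homogenize s i1 in hE; set B := 'X_i2 * homogenize s i2 in hE'.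
have uwE : u * B ^+ M = w * A ^+ N.
  by apply/eqP; rewrite -tofrac_eq !tofracM -hE -hE'; apply/eqP; ring.
have [phi [phiK phiA phiB]] := chart_morphism i12 i10 i20 sm.
rewrite -/A in phiA; rewrite -/B in phiB.
have [f fE] := retract_cancel phiK phiA phiB uwE.
have A0 : A != 0.
  rewrite mulf_neq0 ?mpolyX_neq0 //.
  have x0 : (const_mx 1 : 'rV[F]_3) 0 0 != 0 by rewrite mxE oner_neq0.
  have := @meval_homogenize_neq0 _ s i1 (const_mx 1) sm s0.
  by rewrite x0 => /(_ isT); apply: contraNneq => ->; rewrite meval0.
have hA : A ^+ N \is (N * (size s).-1.+1).-homog.
  rewrite mulnC; apply: dhomogMn.
  exact: (dhomogM (homogX1 _ _) (homogenize_homog _ _)).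
pose b (j : 'I_3) : K := (j == i1)%:R.
pose gK : {rmorphism F -> {poly K}} := polyC \o in_alg K.
have [C1 C10 C1E] : exists2 C1 : {poly K}, C1.[0] != 0 &
    mmap gK (fun j => (a j)%:P + b j *: 'X) A = 'X * C1.
  exists (mmap gK (fun j => (a j)%:P + b j *: 'X) 'X_i1 * C).
    rewrite hornerM horner0_mmap_line mmapX mmap1U mulf_neq0 //.
    exact: coord_neq0.
  by rewrite rmorphM /= CE mulrCA.
(* only the shape of A along the direction b is used from here on *)
clearbody A B; have AN0 : A ^+ N != 0 by rewrite expf_neq0.
have hf : f \is m.-homog.
  by apply: (dhomog_factor hA AN0); rewrite mulrC -fE addnC.
exists f; split; first exact: hf; last first.
  apply: (mulIf (_ : tofrac (A ^+ N) != 0)); first by rewrite tofrac_eq0.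
  by rewrite hE fE tofracM.
apply: (point_ideal_homog hf).
have [D] := ideal_pow_dvdXn b Iu; rewrite fE rmorphM rmorphXn /= C1E => DE.
have XN0 : ('X^N : {poly K}) != 0 by rewrite monic_neq0 ?monicXn.
have /(mulIf XN0) : mmap gK (fun j => (a j)%:P + b j *: 'X) f * C1 ^+ N * 'X^N
    = D * 'X * 'X^N.
  by rewrite -[RHS]mulrA -exprS -[N.+1]addn1 -DE exprMn [in RHS]mulrA mulrAC.
move/(congr1 (horner^~ 0)); rewrite !hornerM hornerX mulr0 horner_exp.
move/eqP; rewrite mulf_eq0 expf_eq0 (negbTE C10) andbF orbF horner0_mmap_line.
by move/eqP.
Qed.

End CubicPoint.

(** * Rational points of the blow-up *)

Section Rees.
Context (F : fieldType) (K : fieldExtType F) (a : 'I_3 -> K).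
Implicit Types (f g r : {mpoly F[3]}) (u v : {poly {mpoly F[3]}}).
Implicit Types chi : {poly {mpoly F[3]}} -> F.
Local Notation I := (point_ideal a).

Lemma ideal_pow_zero n : ideal_pow I n 0.
Proof.
have I0 : I 0 by apply: (@point_ideal_homog _ _ _ 0); rewrite ?dhomog0 ?mmap0.
elim: n => [|n IH]; first exact: ideal_pow0.
by rewrite -(mulr0 0); apply: ideal_powM.
Qed.

Lemma rees_monomial n f : ideal_pow I n f -> rees I (f *: 'X^n).
Proof.
move=> If k; rewrite coefZ coefXn; have [->|_] := eqVneq k n; first by rewrite mulr1.
by rewrite mulr0; apply: ideal_pow_zero.
Qed.

Lemma rees_const f : rees I f%:P.
Proof. by rewrite -alg_polyC -[1](expr0 'X); apply/rees_monomial/ideal_pow0. Qed.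

Lemma chi_monomialM chi m n f g : blowup_point I chi ->
  ideal_pow I m f -> ideal_pow I n g ->
  chi ((f * g) *: 'X^(m + n)) = chi (f *: 'X^m) * chi (g *: 'X^n).
Proof.
move=> hchi If Ig.
rewrite -(blowup_pointM hchi) ?(rees_monomial If) ?(rees_monomial Ig) //.
  by congr chi; rewrite -scalerAl -scalerAr scalerA exprD.
- exact: rees_monomial.
- exact: rees_monomial.
Qed.

Lemma chi_monomial0 chi f : chi (f *: 'X^0) = chi f%:P.
Proof. by rewrite expr0 alg_polyC. Qed.

(** The image in the plane of a point of the blow-up. *)
Definition base_point chi : 'rV[F]_3 := \row_i chi ('X_i)%:P.

Lemma chi_const chi f : blowup_point I chi -> chi f%:P = f.@[base_point chi 0].
Proof.
move=> hchi; elim/mpoly_ring_ind: f => [c|i|f g IHf IHg|f g IHf IHg].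
- by rewrite (blowup_pointC hchi) mevalC.
- by rewrite mevalXU mxE.
- by rewrite polyCD (blowup_pointD hchi) ?IHf ?IHg ?mevalD //; apply: rees_const.
- by rewrite polyCM (blowup_pointM hchi) ?IHf ?IHg ?mevalM //; apply: rees_const.
Qed.

Lemma base_point_neq0 chi : blowup_point I chi -> base_point chi != 0.
Proof.
move=> hchi; have [l /homog1_lform [c lE]] := blowup_point_base hchi.
rewrite (chi_const _ hchi) lE meval_lform; apply: contraNneq => ->.
by rewrite mul0mx mxE.
Qed.

(** On every chart the value is the quotient of chi (f (l g)^N t^(N+1)) by
   chi (l g t)^N, and chi is multiplicative. *)
Lemma section_valueE chi m f w : blowup_point I chi ->
  f \is m.-homog -> I f ->
  section_value I m 1 (tofrac f) chi w <-> w = chi (f *: 'X).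
Proof.
move=> hchi hf If; split.
  case=> d [l [g [N [u [[hl hg Ig] cl cg [hu Iu fE] ->]]]]].
  have {fE} -> : u = f * (l * g) ^+ N.
    by apply/eqP; rewrite -tofrac_eq -fE -tofracM.
  have IgN := ideal_pow_exp N Ig.
  rewrite exprMn addnC (chi_monomialM hchi (ideal_pow1 If)) ?expr1; last first.
    exact: ideal_powMl.
  rewrite -[N in 'X^N]add0n (chi_monomialM hchi (ideal_pow0 _ _)) //.
  rewrite chi_monomial0.
  have -> : chi (l ^+ N)%:P = chi l%:P ^+ N.
    by rewrite !(chi_const _ hchi) rmorphXn.
  have -> : chi (g ^+ N *: 'X^N) = chi (g *: 'X) ^+ N.
    elim: (N) => [|k IHk].
      by rewrite chi_monomial0 (chi_const _ hchi) meval1.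
    rewrite [g ^+ _]exprS [RHS]exprS -[k.+1]add1n.
    rewrite (chi_monomialM hchi (ideal_pow1 Ig)) ?IHk ?expr1 //.
    exact: ideal_pow_exp.
  by rewrite -exprMn mulfK // expf_neq0 // mulf_neq0.
move=> ->; have [l hl cl] := blowup_point_base hchi.
have [d [g [hg Ig cg]]] := blowup_point_fibre hchi.
exists d, l, g, 0%N, f; split=> //; last by rewrite expr0 divr1 add0n expr1.
split; first by rewrite mul0n addn0.
  exact: ideal_pow1.
by rewrite expr0 rmorph1 mulr1.
Qed.

Hypothesis nonvanish : forall x : 'rV[F]_3, x != 0 ->
  exists d f, [/\ f \is d.-homog, I f & f.@[x 0] != 0].

(** For f and g in I, evaluating chi at f g t in two ways gives
   chi (f t) g(p) = chi (g t) f(p), where p is the point below chi; so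
   chi (f t) / f(p) is a constant. *)
Lemma chi_scale chi : blowup_point I chi -> exists2 mu, mu != 0 &
  forall n f, ideal_pow I n f -> chi (f *: 'X^n) = mu ^+ n * f.@[base_point chi 0].
Proof.
move=> hchi; have p0 := base_point_neq0 hchi; set p := base_point chi in p0 *.
have [e [g0 [hg0 Ig0 g0p]]] := nonvanish p0.
pose mu := chi (g0 *: 'X) / g0.@[p 0].
have chi1 f : I f -> chi (f *: 'X) = mu * f.@[p 0].
  move=> If; apply: (mulIf g0p).
  have e1 : chi ((f * g0) *: 'X) = chi (f *: 'X) * g0.@[p 0].
    have := chi_monomialM hchi (ideal_pow1 If) (ideal_pow0 I g0).
    by rewrite !expr1 chi_monomial0 (chi_const _ hchi).
  rewrite -e1 mulrC; have := chi_monomialM hchi (ideal_pow0 I f) (ideal_pow1 Ig0).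
  rewrite add0n !expr1 mulrC => ->.
  by rewrite chi_monomial0 (chi_const _ hchi) /mu mulrAC divfK // mulrC.
exists mu.
  have [d [g [hg Ig]]] := blowup_point_fibre hchi.
  by rewrite (chi1 _ Ig); apply: contraNneq => ->; rewrite mul0r.
move=> n f; elim=> {n f} [f|n f g If Ig IHg|n f g If IHf Ig IHg].
- by rewrite chi_monomial0 (chi_const _ hchi) mul1r.
- rewrite -[n.+1]add1n (chi_monomialM hchi (ideal_pow1 If) Ig) expr1 (chi1 _ If) IHg.
  by rewrite add1n exprS mevalM; ring.
- rewrite scalerDl (blowup_pointD hchi) ?IHf ?IHg ?mevalD ?mulrDr //.
  + exact: rees_monomial.
  + exact: rees_monomial.
Qed.

Lemma same_pointE chi chi' : blowup_point I chi -> blowup_point I chi' ->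
  same_point I chi chi' <-> exists c, base_point chi' = c *: base_point chi.
Proof.
move=> hchi hchi'; split.
  case=> c [mu [_ _ h]]; exists c; apply/rowP => i; rewrite !mxE.
  have := h 1%N 0%N 'X_i; rewrite !chi_monomial0 !expr1 expr0 mulr1; apply.
    exact: homogX1.
  exact: ideal_pow0.
case=> c pE; have p0 := base_point_neq0 hchi.
have c0 : c != 0.
  by apply: contraNneq (base_point_neq0 hchi'); rewrite pE => ->; rewrite scale0r.
have [mu mu0 muE] := chi_scale hchi; have [mu' mu'0 mu'E] := chi_scale hchi'.
exists c, (mu' / mu); split=> //; first by rewrite mulf_neq0 ?invr_neq0.
move=> m n f hf If; rewrite (muE _ _ If) (mu'E _ _ If) pE (meval_homogZ hf).
rewrite exprMn exprVn; field.
by rewrite expf_neq0.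
Qed.

(** The morphism that sends t to 1 and evaluates the coefficients at x. *)
Definition point_over (x : 'rV[F]_3) (u : {poly {mpoly F[3]}}) : F :=
  u.[1].@[x 0].

Lemma point_over_blowup x : x != 0 -> blowup_point I (point_over x).
Proof.
move=> x0; have [d [f [hf If fx]]] := nonvanish x0; split.
- by move=> c; rewrite /point_over hornerC mevalC.
- by move=> u v _ _; rewrite /point_over hornerD mevalD.
- by move=> u v _ _; rewrite /point_over hornerM mevalM.
- have /rV0Pn [i xi] := x0; exists 'X_i; first exact: homogX1.
  by rewrite /point_over hornerC mevalXU.
- by exists d, f; rewrite /point_over hornerZ hornerX mulr1.
Qed.

Lemma base_point_over x : base_point (point_over x) = x.
Proof. by apply/rowP => i; rewrite mxE /point_over hornerC mevalXU. Qed.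

Lemma rational_points_reps n (pts : 'I_n -> {poly {mpoly F[3]}} -> F) :
  rational_points I pts -> proj_reps (fun i => base_point (pts i)).
Proof.
case=> hpts inj surj; split=> [i|i j c e|v v0].
- exact: base_point_neq0.
- by apply/esym/inj/(same_pointE _ _) => //; exists c.
have [i /(same_pointE _ _) h] := surj _ (point_over_blowup v0).
have [] := h; [exact: hpts|exact: point_over_blowup|].
by move=> c; rewrite base_point_over => ->; exists i, c.
Qed.

Lemma reps_rational_points n (p : 'I_n -> 'rV[F]_3) :
  proj_reps p -> rational_points I (fun i => point_over (p i)).
Proof.
case=> p0 inj surj; have hp i := point_over_blowup (p0 i).
split=> // [i j /(same_pointE (hp i) (hp j))|chi hchi].
  by rewrite !base_point_over => -[c e]; apply/esym/(inj _ _ c).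
have [i [c e]] := surj _ (base_point_neq0 hchi); exists i.
by apply/(same_pointE (hp i) hchi); exists c; rewrite base_point_over.
Qed.

End Rees.

(** Normalize the first nonzero coordinate to 1. *)
Lemma proj_reps_exist (F : finFieldType) :
  exists n (p : 'I_n -> 'rV[F]_3), proj_reps p.
Proof.
pose normal (v : 'rV[F]_3) := [exists i : 'I_3, (v 0 i == 1)
   && [forall (j : 'I_3 | (j < i)%N), v 0 j == 0]].
pose S := [set v | normal v].
exists #|S|, enum_val.
have first1 v : normal v -> exists i : 'I_3, v 0 i = 1 /\
    forall j : 'I_3, (j < i)%N -> v 0 j = 0.
  by case/existsP => i /andP [/eqP vi /forall_inP h]; exists i; split=> // j /h /eqP.
split=> [k|k l c e|v v0].
- have := enum_valP k; rewrite inE => /first1 [i [vi _]].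
  by apply/rV0Pn; exists i; rewrite vi oner_neq0.
- have := enum_valP k; rewrite inE => /first1 [i [ki k0]].
  have := enum_valP l; rewrite inE => /first1 [j [lj l0]].
  have cij : c * enum_val l 0 i = 1 by rewrite -ki e mxE.
  have ckj : enum_val k 0 j = c by rewrite e mxE lj mulr1.
  have c0 : c != 0.
    by apply: contra_eq_neq cij => ->; rewrite mul0r eq_sym oner_neq0.
  case: (ltngtP i j) => [ij|ji|/val_inj ij].
  + by move: cij; rewrite l0 // mulr0 => /eqP; rewrite eq_sym oner_eq0.
  + by move: c0; rewrite -ckj k0 // eqxx.
  + by apply: enum_val_inj; rewrite e -ckj -ij ki scale1r.
have /rV0Pn [i0 vi0] := v0.
have [i vi imin] := @arg_minnP _ i0 (fun i => v 0 i != 0) (fun i : 'I_3 => i : nat) vi0.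
have nv : (v 0 i)^-1 *: v \in S.
  rewrite inE; apply/existsP; exists i; rewrite mxE mulVf // eqxx /=.
  apply/forall_inP => j ji; rewrite mxE mulf_eq0 orbC.
  by apply/orP; left; apply: contraLR ji; rewrite -leqNgt => /imin.
exists (enum_rank_in nv ((v 0 i)^-1 *: v)), (v 0 i).
by rewrite enum_rankK_in // scalerA divff // scale1r.
Qed.

(** * The code of quartic forms *)

Section Code.
Context (F : finFieldType) (K : fieldExtType F) (a : 'I_3 -> K).
Hypotheses (hdeg : point_degree a = 3%N) (hline : ~ on_rational_line a).
Implicit Types f g r : {mpoly F[3]}.
Local Notation I := (point_ideal a).
Local Notation ev := (mmap (in_alg K) a).
Let q := #|F|.

Lemma point_ideal_nonvanish (x : 'rV[F]_3) : x != 0 ->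
  exists d f, [/\ f \is d.-homog, I f & f.@[x 0] != 0].
Proof.
case/rV0Pn => i xi; have [s [sm s0 sI]] := separating_forms hline hdeg.
have [j [j0 xj]] : exists j : 'I_3, j != 0 /\ (x 0 0 != 0) || (x 0 j != 0).
  have [i0|i0] := eqVneq i 0; last by exists i; rewrite xi orbT.
  by exists (inord 1); rewrite -val_eqE /= inordK // -i0 xi.
exists (size s).-1, (homogenize s j); split.
- exact: homogenize_homog.
- by have [] := sI _ j0.
- exact: meval_homogenize_neq0.
Qed.

Let z : 3.-tuple K := [tuple a i / a 0 | i < 3].

Lemma ev_lform_ratio (c : 'cV[F]_3) : ev (lform c) = a 0 * \sum_i c i 0 *: z`_i.
Proof.
rewrite ev_lform mulr_sumr; apply: eq_bigr => i _.
rewrite -scalerAr -tnth_nth tnth_mktuple mulrCA divff ?mulr1 //.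
exact: coord_neq0 hline 0.
Qed.

(** A linear relation is a rational line through the point. *)
Lemma free_coords : free z.
Proof.
apply/freeP => k h i.
have c0 : lform (\col_i k i) = 0.
  apply/eqP/negPn/negP => /(ev_linear_neq0 hline (lform_homog _)) /eqP; apply.
  rewrite ev_lform_ratio (_ : \sum_i _ = 0) ?mulr0 // -[RHS]h.
  by apply: eq_bigr => j _; rewrite mxE.
by have := mcoeff_lform (\col_i k i) i; rewrite c0 mcoeff0 mxE.
Qed.

(** Both sides have dimension 3. *)
Lemma residue_field_span : residue_field a = <<z>>%VS.
Proof.
apply/esym/eqP; rewrite eqEdim -[X in (X <= _)%N]/(point_degree a) hdeg.
move: free_coords; rewrite /free size_tuple => /eqP ->; rewrite leqnn andbT.
apply/span_subvP => _ /tnthP [i ->]; rewrite tnth_mktuple.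
exact: coord_ratio_residue.
Qed.

Let quartic := dhomog 3 F 4.
Let value (f : quartic) : K := (a 0) ^- 4 * ev (val f).

Let value_linear : linear value.
Proof.
by move=> c f g; rewrite /value /= mmapD mmapZ mulr_algl mulrDr -scalerAr.
Qed.
HB.instance Definition _ := GRing.isLinear.Build F quartic K _ value value_linear.

(** Quartic forms take values in the residue field, which is spanned by the
   values of the forms X_0^3 X_i. *)
Lemma value_img : limg (linfun value) = residue_field a.
Proof.
apply/eqP; rewrite eqEsubv; apply/andP; split.
  apply/subvP => _ /memv_imgP [f _ ->]; rewrite lfunE /= /value.
  pose y i := a i / a 0.
  have -> : ev (val f) = a 0 ^+ 4 * mmap (in_alg K) y (val f).
    rewrite -mmap_homogZ ?dhomog_is_dhomog //; apply: eq_mmap => // i.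
    by rewrite mulrCA divff ?mulr1 // (coord_neq0 hline).
  rewrite mulKf ?expf_neq0 ?(coord_neq0 hline) //.
  rewrite /residue_field; apply: rpred_sum => m _; apply: rpredM.
    by rewrite /= rpredZ // rpred1.
  by apply: rpred_prod => i _; apply: rpredX; apply: coord_ratio_residue.
rewrite residue_field_span; apply/span_subvP => _ /tnthP [i ->].
rewrite tnth_mktuple.
have hX : ('X_0 ^+ 3 * 'X_i : {mpoly F[3]}) \is 4.-homog.
  by apply: (dhomogM (homogX _ _ 3)); apply: homogX1.
apply/memv_imgP; exists (DHomog hX); first exact: memvf.
rewrite lfunE /= /value rmorphM rmorphXn /= !mmapX !mmap1U.
have a0 := coord_neq0 hline 0; field; exact: a0.
Qed.

Lemma dim_value_ker : \dim (lker (linfun value)) = 12%N.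
Proof.
have := limg_ker_dim (linfun value) fullv.
rewrite capfv value_img -/(point_degree a) hdeg dimvf (_ : dim quartic = 15%N) //; lia.
Qed.

Lemma mem_value_ker f (hf : f \is 4.-homog) :
  (DHomog hf \in lker (linfun value)) = (ev f == 0).
Proof.
rewrite memv_ker lfunE /= /value mulf_eq0 invr_eq0 expf_eq0 /=.
by rewrite (negbTE (coord_neq0 hline 0)).
Qed.

Section Evaluation.
Context (n : nat) (pts : 'I_n -> {poly {mpoly F[3]}} -> F).
Hypotheses (hpts : rational_points I pts) (q_ge4 : (4 <= q)%N).
Let p i := base_point (pts i).

Let hp : proj_reps p.
Proof. exact: (rational_points_reps point_ideal_nonvanish). Qed.

Let nE : n = (q ^ 2 + q + 1)%N. Proof. exact: card_proj_reps hp. Qed.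

Lemma pzeros_quartic_le f : f \is 4.-homog -> f != 0 -> ev f = 0 ->
  (#|pzeros p f| <= 3 * q + 2)%N.
Proof. by apply: (quartic_bound hp); apply: ev_linear_neq0. Qed.

(** By [chi_scale], the word of f has coordinates mu_i f(p_i) with mu_i nonzero,
   so its weight is the number of rational points where f is not zero. *)
Lemma code_parameters_quartic f0 :
  f0 \is 4.-homog -> ev f0 = 0 -> #|pzeros p f0| = (3 * q + 2)%N ->
  code_parameters (ag_code I 4 1 pts) (q ^ 2 + q + 1) 12 (q ^ 2 - 2 * q - 1).
Proof.
move=> hf0 ef0 N0; have [bp _ _] := hpts.
have /fin_all_exists2 [mu mu0 muE] := fun i =>
  chi_scale point_ideal_nonvanish (bp i).
have q2 : (4 * q <= q ^ 2)%N by rewrite -mulnn leq_mul2r q_ge4 orbT.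
pose code f : 'rV[F]_n := \row_i (mu i * f.@[p i 0]).
have code_lin : linear (fun f : quartic => code (val f)).
  move=> c f g; apply/rowP => i; rewrite !mxE /= mevalD mevalZ; ring.
pose codeL : {linear quartic -> 'rV[F]_n} :=
  HB.pack (fun f : quartic => code (val f))
    (GRing.isLinear.Build F quartic 'rV[F]_n _ _ code_lin).
have codeE f i : I f -> code f 0 i = pts i (f *: 'X).
  by move=> If; have := muE i _ _ (ideal_pow1 If); rewrite !expr1 mxE => ->.
pose wt f := #|[set i | code f 0 i != 0]|.
have weight f : wt f = (n - #|pzeros p f|)%N.
  rewrite /wt.
  have -> : [set i | code f 0 i != 0] = ~: pzeros p f.
    by apply/setP => i; rewrite !inE mxE mulf_eq0 (negbTE (mu0 i)).
  by rewrite cardsCs setCK card_ord.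
have heavy f : f \is 4.-homog -> f != 0 -> ev f = 0 ->
    (q ^ 2 - 2 * q - 1 <= wt f)%N.
  move=> hf fn0 ef; rewrite weight; have := nE.
  by have := pzeros_quartic_le hf fn0 ef; lia.
split; first exact: nE.
pose C := (linfun codeL @: lker (linfun value))%VS.
have C_P w : w \in C -> exists f, [/\ f \is 4.-homog, ev f = 0 & w = code f].
  case/memv_imgP => -[f hf]; rewrite mem_value_ker => /eqP ef ->.
  by exists f; rewrite lfunE.
have C_code f : f \is 4.-homog -> ev f = 0 -> code f \in C.
  move=> hf ef; apply/memv_imgP; exists (DHomog hf); last by rewrite lfunE.
  by rewrite mem_value_ker ef.
exists C; split.
- move=> w; split=> [/C_P [f [hf ef ->]]|[h /(global_section_ideal hline hdeg)]].
    have If := point_ideal_homog hf ef; exists (tofrac f).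
      by apply/(global_section_ideal hline hdeg); exists f.
    by move=> i; apply/(section_valueE _ (bp i) hf If); apply: codeE.
  case=> f [hf If ->] hw; suff -> : w = code f.
    by apply: C_code => //; apply: point_ideal_eval.
  apply/rowP => i; rewrite (codeE _ _ If).
  exact/(section_valueE _ (bp i) hf If).
- rewrite -dim_value_ker; apply: limg_dim_eq; apply/eqP; rewrite -subv0.
  apply/subvP => -[f hf]; rewrite memv_cap mem_value_ker memv_ker lfunE /=.
  case/andP=> /eqP ef /eqP cf; rewrite memv0.
  suff fz : f = 0 by apply/eqP/val_inj.
  apply/eqP/negPn/negP => fn0; have := heavy f hf fn0 ef.
  rewrite /wt cf (_ : [set i | _] = set0) ?cards0; last first.
    by apply/setP => i; rewrite !inE mxE eqxx.
  lia.
- split.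
    exists (code f0), 0; split; first exact: C_code.
    + exact: mem0v.
    + apply/eqP => c0; have := weight f0; rewrite /wt c0 (_ : [set i | _] = set0).
        rewrite cards0 N0; have := nE; lia.
      by apply/setP => i; rewrite !inE mxE eqxx.
    + transitivity (wt f0); last by rewrite weight N0; have := nE; lia.
      by apply: eq_card => i; rewrite !inE [(0 : 'rV_n) _ _]mxE.
  move=> v w /C_P [f [hf ef ->]] /C_P [g [hg eg ->]] ne.
  have hfg : f - g \is 4.-homog by rewrite rpredB.
  have efg : ev (f - g) = 0 by rewrite mmapB ef eg subrr.
  have fg0 : f - g != 0.
    by apply: contraNneq ne => /eqP; rewrite subr_eq0 => /eqP ->.
  rewrite (leq_trans (heavy _ hfg fg0 efg)) // subset_leq_card //.
  apply/subsetP => i; rewrite !inE !mxE mevalB mulrBr subr_eq0.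
  by [].
Qed.
End Evaluation.
End Code.

(** * A quartic with the maximal number of zeros *)

(** The degree of x over F divides 3. *)
Lemma cubic_not_quadratic (F : fieldType) (K : fieldExtType F)
    (E : {subfield K}) (x : K) (c0 c1 : F) :
  \dim E = 3%N -> x \in E -> x \notin 1%VS -> x ^+ 2 <> c0 *: 1 + c1 *: x.
Proof.
move=> dE xE x1 e.
have : (\dim <<1; x>>%AS %| \dim E)%N.
  by apply: field_dimS; apply/FadjoinP; rewrite sub1v.
rewrite dE -/(is_true _) dim_Fadjoin dimv1 muln1 => dvd.
have : (adjoin_degree 1 x <= 2)%N.
  pose p : {poly K} := 'X^2 - (c1%:A *: 'X + c0%:A%:P).
  have sl : (size (c1%:A *: 'X + c0%:A%:P : {poly K})%R <= 2)%N.
    rewrite (leq_trans (size_polyD _ _)) // geq_max.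
    rewrite (leq_trans (size_scale_leq _ _)) ?size_polyX //.
    by rewrite (leq_trans (size_polyC_leq1 _)).
  have sp : size p = 3%N.
    by rewrite size_polyDl ?size_polyXn // size_polyN ltnS.
  have p0 : p != 0 by rewrite -size_poly_eq0 sp.
  have pK : p \is a polyOver 1%AS.
    by rewrite rpredB ?rpredX ?polyOverX // rpredD ?polyOverC ?polyOverZ
      ?polyOverX ?rpredZ ?rpred1.
  have rp : root p x.
    by rewrite rootE !hornerE e -!scalerAl !mul1r [_ + c1 *: x]addrC subrr.
  by have := dvdp_leq p0 (minPoly_dvdp pK rp); rewrite sp size_minPoly.
have := adjoin_deg_eq1 1%AS x; rewrite (negbTE x1).
by move: dvd; rewrite /adjoin_degree; case: (_.-1) => [|[|k]].
Qed.

Section Extremal.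
Context (F : finFieldType) (K : fieldExtType F) (a : 'I_3 -> K).
Hypotheses (hdeg : point_degree a = 3%N) (hline : ~ on_rational_line a).
Local Notation ev := (mmap (in_alg K) a).

(** The ratios a_i / a_0 form a basis of the residue field, so a_1^2 / a_0^2 is
   a linear combination of them; it involves a_2 because a_1 / a_0 is not
   quadratic over F. *)
Lemma square_coordinates : exists c : 'cV[F]_3,
  c (inord 2) 0 != 0 /\ a 0 * ev (lform c) = a 1 ^+ 2.
Proof.
pose x := a 1 / a 0; have a0 := coord_neq0 hline 0.
have xE : x \in residue_field a by exact: coord_ratio_residue.
have : x ^+ 2 \in residue_field a by rewrite /residue_field rpredX.
rewrite (residue_field_span hdeg hline) => /coord_span.
set z := [tuple _ | _ < 3] => e; pose c : 'cV[F]_3 := \col_i coord z i (x ^+ 2).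
have cE : \sum_i c i 0 *: z`_i = x ^+ 2.
  by rewrite e; apply: eq_bigr => i _; rewrite mxE.
exists c; split; last first.
  rewrite (ev_lform_ratio hline) cE mulrA -expr2 -exprMn /x mulrCA divff //.
  by rewrite mulr1.
apply/negP => /eqP c2.
have x1 : x \notin 1%VS by apply: coord_ratio_irrational.
pose E := <<1 & [seq a ij.1 / a ij.2 | ij : 'I_3 * 'I_3]>>%AS.
apply: (@cubic_not_quadratic F K E x (c 0 0) (c 1 0)) => //.
rewrite -cE !big_ord_recl big_ord0 addr0.
rewrite (_ : lift ord0 (lift ord0 ord0) = inord 2); last first.
  by apply/val_inj; rewrite /= inordK.
rewrite c2 scale0r addr0 (_ : lift ord0 ord0 = 1); last exact/val_inj.
by rewrite -!tnth_nth !tnth_mktuple divff.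
Qed.

Lemma extremal_quartic n (p : 'I_n -> 'rV[F]_3) : proj_reps p -> (4 <= #|F|)%N ->
  exists f, [/\ f \is 4.-homog, ev f = 0 & #|pzeros p f| = (3 * #|F| + 2)%N].
Proof.
move=> hp q4; have [c [c2 cE]] := square_coordinates.
have [l1 [l2 [h1 h2 n0 N]]] := conic_two_external_lines hp (ltnW q4) c2.
have hf : conic c * (l1 * l2) \is 4.-homog.
  by apply: (dhomogM (conic_homog c)); apply: (dhomogM h1 h2).
have ef : ev (conic c * (l1 * l2)) = 0.
  rewrite rmorphM /= /conic mmapB rmorphM rmorphXn /= !mmapX !mmap1U.
  by rewrite cE subrr mul0r.
exists (conic c * (l1 * l2)); split; [exact: hf|exact: ef|].
apply/eqP; rewrite eqn_leq N andbT.
by apply: (quartic_bound hp _ hf n0 ef); apply: ev_linear_neq0.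
Qed.
End Extremal.

Theorem theorem3p10 (F : finFieldType) (q : nat) (hq : #|F| = q)
    (hq4 : (4 <= q)%N)
    (K : fieldExtType F) (a : 'I_3 -> K) (ha : hom_coords a)
    (hdeg : point_degree a = 3%N) (hline : ~ on_rational_line a) :
  (exists n (pts : 'I_n -> {poly {mpoly F[3]}} -> F),
     rational_points (point_ideal a) pts) /\
  (forall n (pts : 'I_n -> {poly {mpoly F[3]}} -> F),
     rational_points (point_ideal a) pts ->
     code_parameters (ag_code (point_ideal a) 4 1 pts)
       (q ^ 2 + q + 1) 12 (q ^ 2 - 2 * q - 1)).
Proof.
have nv := point_ideal_nonvanish hdeg hline; split.
  have [n [p hp]] := proj_reps_exist F.
  by exists n, (fun i => point_over (p i)); apply: reps_rational_points.
move=> n pts hpts; rewrite -hq in hq4 *.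
have hp := rational_points_reps nv hpts.
have [f [hf ef N]] := extremal_quartic hdeg hline hp hq4.
exact: (code_parameters_quartic hdeg hline hpts hq4 hf ef N).
Qed.
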